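(* The variational problem: find $(\mathbf{u},\boldsymbol{\epsilon}_1,\boldsymbol{\epsilon}_2,\boldsymbol{\sigma}_1,\boldsymbol{\sigma}_2)\in V\times W\times W\times W\times W$ such that $$\int_\Omega\boldsymbol{\sigma}_1:\mathbf{B}\mathbf{v}\,d\Omega+\int_\Omega(-\boldsymbol{\sigma}_1+\boldsymbol{\sigma}_2):\boldsymbol{\delta}_1\,d\Omega+\int_\Omega(\mathbf{D}\boldsymbol{\epsilon}_2-\boldsymbol{\sigma}_2):\boldsymbol{\delta}_2\,d\Omega=f(\mathbf{v})\quad\forall\,\mathbf{v}\in V,\ \boldsymbol{\delta}_1,\boldsymbol{\delta}_2\in W,$$ $$\int_\Omega\boldsymbol{\tau}_1:(\mathbf{B}\mathbf{u}-\boldsymbol{\epsilon}_1)\,d\Omega+\int_\Omega\boldsymbol{\tau}_2:(\boldsymbol{\epsilon}_1-\boldsymbol{\epsilon}_2)\,d\Omega=0\quad\forall\,\boldsymbol{\tau}_1,\boldsymbol{\tau}_2\in W,$$ has a unique solution. Moreover, $\mathbf{u}$ solves $$\int_\Omega\mathbf{D}\mathbf{B}\mathbf{u}:\mathbf{B}\mathbf{v}\,d\Omega=f(\mathbf{v})\quad\forall\,\mathbf{v}\in V,$$ and the following relations hold: $$\boldsymbol{\epsilon}_1=\boldsymbol{\epsilon}_2=\mathbf{B}\mathbf{u},\qquad\boldsymbol{\sigma}_1=\boldsymbol{\sigma}_2=\mathbf{D}\mathbf{B}\mathbf{u}.$$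
   Context: $\Omega\subset\mathbb{R}^2$ is a bounded polygonal domain, with $\partial\Omega=\Gamma_D\cup\Gamma_N$, $\Gamma_D\neq\emptyset$, $\Gamma_N=\partial\Omega\setminus\Gamma_D$. $V=\{\mathbf{u}\in (H^1(\Omega))^2:\mathbf{u}=\mathbf{0}\text{ on }\Gamma_D\}$, $W=(L^2(\Omega))^3$. For $\mathbf{u}=(u_x,u_y)\in V$, $\mathbf{B}\mathbf{u}=(\partial_x u_x,\ \partial_y u_y,\ \partial_y u_x+\partial_x u_y)^T\in W$. $\mathbf{D}$ is a constant symmetric positive definite $3\times3$ matrix, and $:$ is the Euclidean inner product of $\mathbb{R}^3$. The bilinear form $a(\mathbf{u},\mathbf{v})=\int_\Omega\mathbf{D}\mathbf{B}\mathbf{u}:\mathbf{B}\mathbf{v}\,d\Omega$ is taken to be symmetric, continuous and coercive on $V$. $f$ is the continuous linear functional on $V$ given by $f(\mathbf{u})=\int_\Omega\mathbf{b}\cdot\mathbf{u}\,d\Omega+\int_{\Gamma_N}\mathbf{t}\cdot\mathbf{u}\,d\Gamma$, with body force $\mathbf{b}$ and prescribed traction $\mathbf{t}$. *)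

(* Defs.v *)
From HB Require Import structures.
From mathcomp Require Import all_boot all_order all_algebra.
From mathcomp Require Import all_classical all_reals all_analysis.
Set Implicit Arguments.
Unset Strict Implicit.
Unset Printing Implicit Defensive.
Import Order.TTheory GRing.Theory Num.Theory.
Import numFieldNormedType.Exports.
Local Open Scope classical_set_scope.
Local Open Scope ring_scope.

(* Elements of L^2, H^1, V and W are represented by functions on the whole
   plane whose values outside Omega are irrelevant; equality in these spaces
   is equality almost everywhere on Omega (ae_eq). *)

Notation leb R := (@lebesgue_measure R).
Notation area R := (@lebesgue_measure R \x @lebesgue_measure R)%E.

Section plane.
Context {R : realType}.
Implicit Types (Om Ga : set (R * R)) (e : (R * R) * (R * R))
  (es : seq ((R * R) * (R * R))).

Definition dotv n (x y : 'cV[R]_n) : R := (x^T *m y) 0 0.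

Definition edge_path e (s : R) : R * R :=
  (e.1.1 + s * (e.2.1 - e.1.1), e.1.2 + s * (e.2.2 - e.1.2)).

Definition edge_length e : R :=
  Num.sqrt ((e.2.1 - e.1.1) ^+ 2 + (e.2.2 - e.1.2) ^+ 2).

Definition segment e : set (R * R) := edge_path e @` `[0, 1].

Definition boundary Om : set (R * R) := closure Om `\` interior Om.

(* es enumerates the sides of the boundary, each one once.  The boundary may
   have several components.  The condition interior (closure Om) = Om says
   that Om lies on one side only of each of its sides (no slits), so that
   there is a single-valued trace on the boundary. *)
Record polygonal_domain Om es : Prop := PolygonalDomain {
  poly_open : open Om ;
  poly_connected : connected Om ;
  poly_bounded : bounded_set Om ;
  poly_one_sided : interior (closure Om) = Om ;
  poly_uniq : uniq es ;
  poly_nondegenerate : forall e, e \in es -> e.1 != e.2 ;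
  poly_meet : forall e e', e \in es -> e' \in es -> e != e' ->
    segment e `&` segment e' `<=` [set e.1; e.2] `&` [set e'.1; e'.2] ;
  poly_boundary : boundary Om = \bigcup_(e in [set` es]) segment e
}.

(* Square-integrable functions on A for the measure mu *)
Definition L2 d (T : measurableType d) (mu : {measure set T -> \bar R})
    (A : set T) (g : T -> R) : Prop :=
  measurable_fun A g /\ mu.-integrable A (fun x => (g x ^+ 2)%:E).

(* Integration with respect to arc length on a subset Ga of the union of the
   sides es *)
Definition edge_part e Ga : set R :=
  `[0, 1] `&` (edge_path e @^-1` Ga).

Definition bint es Ga (g : R * R -> R) : R :=
  \sum_(e <- es) edge_length e *
    \int[leb R]_(s in edge_part e Ga) g (edge_path e s).

Definition bintegrable es Ga (g : R * R -> R) : Prop :=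
  forall e, e \in es ->
    (leb R).-integrable (edge_part e Ga) (fun s => (g (edge_path e s))%:E).

Definition bL2 es Ga (g : R * R -> R) : Prop :=
  forall e, e \in es ->
    L2 (leb R) (edge_part e Ga) (g \o edge_path e).

Definition axis (i : 'I_2) : R * R := ((i == 0)%:R, (i == 1)%:R).

Definition partial (i : 'I_2) (phi : R * R -> R) : R * R -> R :=
  fun p => 'D_(axis i) phi p.

(* C^infinity on the plane: s is the list of the successive directions of
   differentiation *)
Definition smooth (phi : R * R -> R) : Prop :=
  forall s : seq 'I_2, let psi := foldr partial phi s in
    continuous psi /\ forall i p, derivable psi p (axis i).

Definition test_function Om (phi : R * R -> R) : Prop :=
  smooth phi /\
  exists K, [/\ compact K, K `<=` Om & forall p, ~ K p -> phi p = 0].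

Definition weak_partial Om (i : 'I_2) (u g : R * R -> R) : Prop :=
  forall phi, test_function Om phi ->
    \int[area R]_(p in Om) (u p * partial i phi p) =
    - \int[area R]_(p in Om) (g p * phi p).

Definition H1 Om (u : R * R -> R) : Prop :=
  L2 (area R) Om u /\
  forall i, exists2 g, L2 (area R) Om g & weak_partial Om i u g.

(* The weak derivative of u : H1 Om (unique almost everywhere on Om) *)
Definition wderiv Om (i : 'I_2) (u : R * R -> R) : R * R -> R :=
  xget (fun=> 0) [set g | L2 (area R) Om g /\ weak_partial Om i u g].

Definition H1norm Om (u : R * R -> R) : R :=
  Num.sqrt (\int[area R]_(p in Om) (u p ^+ 2) +
    \sum_(i < 2) \int[area R]_(p in Om) (wderiv Om i u p ^+ 2)).

(* g is the trace of u : H1 Om on the part Ga of the boundary: the trace is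
   the H^1-continuous extension, with values in L^2(Ga), of the restriction
   map on functions that are smooth up to the boundary. *)
Definition is_trace Om es Ga (u g : R * R -> R) : Prop :=
  bL2 es Ga g /\
  exists phi : (R * R -> R)^nat,
    [/\ forall n, smooth (phi n) /\ H1 Om (phi n),
        (fun n => H1norm Om (fun p => phi n p - u p)) @ \oo --> (0 : R) &
        (fun n => bint es Ga (fun p => (phi n p - g p) ^+ 2)) @ \oo
          --> (0 : R)].

Definition trace Om es Ga (u : R * R -> R) : R * R -> R :=
  xget (fun=> 0) [set g | is_trace Om es Ga u g].

Definition component n (u : R * R -> 'cV[R]_n) (k : 'I_n) : R * R -> R :=
  fun p => u p k 0.

Definition vtrace Om es Ga (u : R * R -> 'cV[R]_2) : R * R -> 'cV[R]_2 :=
  fun p => \col_k trace Om es Ga (component u k) p.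

Definition V Om es GaD : set (R * R -> 'cV[R]_2) :=
  [set u | forall k, H1 Om (component u k) /\
                     is_trace Om es GaD (component u k) (fun=> 0)].

Definition Vnorm Om (u : R * R -> 'cV[R]_2) : R :=
  Num.sqrt (\sum_(k < 2) H1norm Om (component u k) ^+ 2).

Definition W Om : set (R * R -> 'cV[R]_3) :=
  [set e | forall k, L2 (area R) Om (component e k)].

(* The strain operator, in engineering (Voigt) notation *)
Definition B Om (u : R * R -> 'cV[R]_2) : R * R -> 'cV[R]_3 := fun p =>
  \col_(k < 3) [:: wderiv Om 0 (component u 0) p;
                   wderiv Om 1 (component u 1) p;
                   wderiv Om 1 (component u 0) p + wderiv Om 0 (component u 1) p]`_k.

Definition sym_posdef n (D : 'M[R]_n) : Prop :=
  D^T = D /\ forall x : 'cV[R]_n, x != 0 -> 0 < dotv (D *m x) x.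

Definition aform Om (D : 'M[R]_3) (u v : R * R -> 'cV[R]_2) : R :=
  \int[area R]_(p in Om) dotv (D *m B Om u p) (B Om v p).

Definition load Om es GaN (b t v : R * R -> 'cV[R]_2) : R :=
  \int[area R]_(p in Om) dotv (b p) (v p) +
  bint es GaN (fun p => dotv (t p) (vtrace Om es GaN v p)).

Definition load_defined Om es GaD GaN (b t : R * R -> 'cV[R]_2) : Prop :=
  forall v, V Om es GaD v ->
    (area R).-integrable Om (fun p => (dotv (b p) (v p))%:E) /\
    bintegrable es GaN (fun p => dotv (t p) (vtrace Om es GaN v p)).

Definition bounded_linear_on (U : lmodType R) (E : set U) (N f : U -> R) :=
  (forall (c : R) u v, E u -> E v -> f (c *: u + v) = c * f u + f v) /\
  exists C : R, forall v, E v -> `|f v| <= C * N v.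

Definition symmetric_on (U : Type) (E : set U) (a : U -> U -> R) : Prop :=
  forall u v, E u -> E v -> a u v = a v u.

Definition bounded_form_on (U : Type) (E : set U) (N : U -> R)
    (a : U -> U -> R) : Prop :=
  exists C : R, forall u v, E u -> E v -> `|a u v| <= C * N u * N v.

Definition coercive_on (U : Type) (E : set U) (N : U -> R)
    (a : U -> U -> R) : Prop :=
  exists2 alpha : R, 0 < alpha & forall u, E u -> alpha * N u ^+ 2 <= a u u.

Record mixed_solution Om es GaD GaN (D : 'M[R]_3) (b t u : R * R -> 'cV[R]_2)
    (e1 e2 s1 s2 : R * R -> 'cV[R]_3) : Prop := MixedSolution {
  mixed_u : V Om es GaD u ;
  mixed_e1 : W Om e1 ;
  mixed_e2 : W Om e2 ;
  mixed_s1 : W Om s1 ;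
  mixed_s2 : W Om s2 ;
  mixed_eq1 : forall v d1 d2, V Om es GaD v -> W Om d1 -> W Om d2 ->
    \int[area R]_(p in Om) dotv (s1 p) (B Om v p) +
    \int[area R]_(p in Om) dotv (- s1 p + s2 p) (d1 p) +
    \int[area R]_(p in Om) dotv (D *m e2 p - s2 p) (d2 p) =
    load Om es GaN b t v ;
  mixed_eq2 : forall t1 t2, W Om t1 -> W Om t2 ->
    \int[area R]_(p in Om) dotv (t1 p) (B Om u p - e1 p) +
    \int[area R]_(p in Om) dotv (t2 p) (e1 p - e2 p) = 0
}.

End plane.

(* Main.v *)
(* The second equation forces e1 = e2 = Bu and, tested with v = 0, the first one
   forces s1 = s2 = D e2; what remains is the displacement problem, solved by
   minimizing the energy over V.  The minimizing sequence converges because V is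
   complete: L2 is complete (Riesz-Fischer), weak derivatives are closed under
   L2 limits, and a diagonal argument shows that having zero trace on GaD is
   preserved by H1 limits, so that no trace inequality is needed.  The weak
   derivative chosen by [wderiv] is linear only almost everywhere, by the
   fundamental lemma of the calculus of variations. *)
Require Import Defs.
From HB Require Import structures.
From mathcomp Require Import all_boot all_order all_algebra.
From mathcomp Require Import all_classical all_reals all_analysis.
From mathcomp Require Import measurable_realfun ring lra.
Set Implicit Arguments.
Unset Strict Implicit.
Unset Printing Implicit Defensive.
Import Order.TTheory GRing.Theory Num.Theory.
Import numFieldNormedType.Exports.
Local Open Scope classical_set_scope.
Local Open Scope ring_scope.

(** * Square-integrable functions *)

(** Fields are plain functions, so squared norms are only seminorms and [B] is linear only almost
    everywhere. The abstract minimization is therefore stated on a subset [E] of a vector space,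
    with a form that is merely nonnegative; null sets disappear under the integral, so [aform] is
    exactly linear in its first argument on V. Convergence is always measured in squared norm at the
    rate [4^-n]. Near-minimizers within [4^-n] of the infimum produce this rate, its square roots
    [2^-n] are summable, as pointwise convergence in L^2 demands, and it passes through L^2, H^1 and
    V with explicit factors, so that no subsequence is ever extracted. The triangle inequality is
    replaced by [(x + y)^2 <= 2 x^2 + 2 y^2]. The fundamental lemma is reached from test functions
    through smooth bumps that tend to indicators of rectangles, followed by a Dynkin class
    argument. *)

Section square_integrable.
Context d (T : measurableType d) (R : realType).
Variables (mu : {measure set T -> \bar R}) (A : set T) (mA : measurable A).
Implicit Types f g h : T -> R.

Lemma L2_measurable f : L2 mu A f -> measurable_fun A f.
Proof. by case. Qed.

Lemma integrable_EFinD f g : mu.-integrable A (EFin \o f) ->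
  mu.-integrable A (EFin \o g) ->
  mu.-integrable A (EFin \o (fun x => f x + g x)).
Proof. by move=> If Ig; apply: eq_integrable (integrableD mA If Ig). Qed.

Lemma integrable_EFinZ c f : mu.-integrable A (EFin \o f) ->
  mu.-integrable A (EFin \o (fun x => c * f x)).
Proof. by move=> If; apply: eq_integrable (integrableZl mA c If). Qed.

(** The product is dominated by [f ^+ 2 + g ^+ 2], because [(|f| - |g|)^2 >= 0]. *)
Lemma L2M_integrable f g : L2 mu A f -> L2 mu A g ->
  mu.-integrable A (EFin \o (fun x => f x * g x)).
Proof.
move=> [mf If] [mg Ig].
apply: (le_integrable mA _ _ (integrableD mA If Ig)).
  by apply/measurable_EFinP; exact: measurable_funM.
move=> x _ /=; rewrite lee_fin [leRHS]ger0_norm ?addr_ge0 ?sqr_ge0//.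
have := sqr_ge0 (`|f x| - `|g x|).
rewrite -(real_normK (num_real (f x))) -(real_normK (num_real (g x))) normrM.
have := sqr_ge0 `|f x|; have := sqr_ge0 `|g x|; nra.
Qed.

Lemma L2D f g : L2 mu A f -> L2 mu A g -> L2 mu A (fun x => f x + g x).
Proof.
move=> Lf Lg; have Ifg := L2M_integrable Lf Lg.
case: Lf => mf If; case: Lg => mg Ig; split; first exact: measurable_funD.
have := integrableD mA (integrableD mA If Ig) (integrableZl mA 2 Ifg).
by apply: eq_integrable => // x _ /=; rewrite -!EFinD; congr EFin; ring.
Qed.

Lemma L2Z c f : L2 mu A f -> L2 mu A (fun x => c * f x).
Proof.
case=> mf If; split; first exact: measurable_funM.
apply: eq_integrable (integrableZl mA (c ^+ 2) If) => // x _ /=.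
by rewrite exprMn.
Qed.

Lemma L2N f : L2 mu A f -> L2 mu A (fun x => - f x).
Proof.
case=> mf If; split; first exact: measurable_funN.
by apply: eq_integrable If => // x _; rewrite sqrrN.
Qed.

Lemma L2B f g : L2 mu A f -> L2 mu A g -> L2 mu A (fun x => f x - g x).
Proof. by move=> Lf Lg; apply: L2D => //; exact: L2N. Qed.

Lemma L20 : L2 mu A (fun=> 0).
Proof.
split; first exact: measurable_cst.
by apply: eq_integrable (integrable0 _ _) => // x _; rewrite expr0n.
Qed.

Lemma bounded_L2 f M : (mu A < +oo)%E -> measurable_fun A f ->
  (forall x, A x -> `|f x| <= M) -> L2 mu A f.
Proof.
move=> fA mf bf; split=> //.
apply: measurable_bounded_integrable => //; first exact: measurable_funX.
exists (M ^+ 2); split; first exact: num_real.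
move=> y My x Ax; apply: le_trans (ltW My).
have := bf _ Ax; have := normr_ge0 (f x).
rewrite normrX; nra.
Qed.

Lemma Rintegral_ae_eq f g : measurable_fun A f -> measurable_fun A g ->
  ae_eq mu A f g -> \int[mu]_(x in A) f x = \int[mu]_(x in A) g x.
Proof.
move=> mf mg fg; congr fine; apply: ae_eq_integral => //.
- exact/measurable_EFinP.
- exact/measurable_EFinP.
- by apply: filterS fg => x /[apply] ->.
Qed.

Lemma sqr_Rintegral_eq0 f : L2 mu A f ->
  \int[mu]_(x in A) (f x ^+ 2) = 0 -> ae_eq mu A f (fun=> 0).
Proof.
move=> [mf If] If0; have := congr1 EFin If0; rewrite /Rintegral.
(* [Rintegral] is [fine] of the extended integral and [fine] sends infinities to 0; integrability
   rules that reading out. *)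
rewrite (fineK (integrable_fin_num mA If)) => {}If0.
have /(ae_eq_integral_abs _ mA (measurable_int _ If)) :
    (\int[mu]_(x in A) `|(f x ^+ 2)%:E| = 0)%E.
  rewrite -[RHS]If0; apply: eq_integral => x _ /=.
  by rewrite ger0_norm ?sqr_ge0.
apply: filterS => x fx0 Ax; have [f20] := fx0 Ax.
by apply/eqP; rewrite -sqrf_eq0 f20.
Qed.

Lemma L2_sqr_add_le f g : L2 mu A f -> L2 mu A g ->
  \int[mu]_(x in A) ((f x + g x) ^+ 2) <=
  2 * \int[mu]_(x in A) (f x ^+ 2) + 2 * \int[mu]_(x in A) (g x ^+ 2).
Proof.
move=> Lf Lg; have [_ If] := Lf; have [_ Ig] := Lg.
have [_ Ifg] := L2D Lf Lg.
have I2f := integrable_EFinZ 2 If; have I2g := integrable_EFinZ 2 Ig.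
rewrite -!RintegralZl// -RintegralD//.
apply: le_Rintegral => //; first exact: integrable_EFinD.
move=> x _; have := sqr_ge0 (f x - g x); nra.
Qed.

Lemma Rintegral_comb c f g : mu.-integrable A (EFin \o f) ->
    mu.-integrable A (EFin \o g) ->
  \int[mu]_(x in A) (c * f x + g x) =
  c * \int[mu]_(x in A) f x + \int[mu]_(x in A) g x.
Proof.
move=> If Ig; rewrite RintegralD//; first by rewrite RintegralZl.
exact: integrable_EFinZ.
Qed.

End square_integrable.

(** The polynomial is evaluated at its minimum [- b / a]; when [a = 0] and [b != 0] it takes the
    value -1 at [- (c + 1) / (2 * b)]. It yields Cauchy-Schwarz, both for integrals and for an
    abstract form, and also the approximate Euler equation of a near-minimizer. *)
Lemma quad_ge0_discr (R : realFieldType) (a b c : R) :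
  0 <= a -> (forall t, 0 <= a * t ^+ 2 + 2 * b * t + c) -> b ^+ 2 <= a * c.
Proof.
move=> a0 H; have [a_eq0|a_neq0] := eqVneq a 0.
  have [->|b0] := eqVneq b 0; first by rewrite a_eq0 mul0r expr0n.
  have := H (- (c + 1) / (2 * b)); rewrite a_eq0 mul0r add0r.
  have -> : 2 * b * (- (c + 1) / (2 * b)) + c = - 1 by field.
  by rewrite oppr_ge0 ler10.
have a_gt0 : 0 < a by rewrite lt_neqAle eq_sym a_neq0.
have := H (- b / a).
have -> : a * (- b / a) ^+ 2 + 2 * b * (- b / a) + c = (a * c - b ^+ 2) / a.
  by field.
by rewrite pmulr_lge0 ?invr_gt0// subr_ge0.
Qed.

(** * Cauchy-Schwarz and completeness of L^2 *)

Section square_integrable_complete.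
Context d (T : measurableType d) (R : realType).
Variables (mu : {measure set T -> \bar R}) (A : set T) (mA : measurable A).
Implicit Types f g h : T -> R.

Lemma Rintegral_cauchy_schwarz f g : L2 mu A f -> L2 mu A g ->
  (\int[mu]_(x in A) (f x * g x)) ^+ 2 <=
  (\int[mu]_(x in A) (f x ^+ 2)) * (\int[mu]_(x in A) (g x ^+ 2)).
Proof.
move=> Lf Lg; have Ifg := L2M_integrable mA Lf Lg.
have [_ If] := Lf; have [_ Ig] := Lg.
apply: quad_ge0_discr => [|t]; first by apply: Rintegral_ge0 => x _; exact: sqr_ge0.
have -> : \int[mu]_(x in A) (f x ^+ 2) * t ^+ 2 +
    2 * \int[mu]_(x in A) (f x * g x) * t + \int[mu]_(x in A) (g x ^+ 2) =
    \int[mu]_(x in A) ((t * f x + g x) ^+ 2).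
  rewrite mulrC -mulrA (mulrC _ t) mulrA -!addrA -(Rintegral_comb mA)//.
  rewrite -(Rintegral_comb mA)//.
    by apply: eq_Rintegral => x _; ring.
  by apply: integrable_EFinD => //; exact: integrable_EFinZ.
by apply: Rintegral_ge0 => x _; exact: sqr_ge0.
Qed.

(* Increments of size 2^-n in the mean make the series of increments converge
   absolutely almost everywhere; Fatou's lemma then bounds the distance to the
   pointwise limit. *)
Lemma L2_complete (f : (T -> R)^nat) (C : R) : (mu A < +oo)%E ->
    (forall n, L2 mu A (f n)) ->
    (forall n m, (n <= m)%N ->
      \int[mu]_(x in A) ((f m x - f n x) ^+ 2) <= C * 4 ^- n) ->
  exists2 g, L2 mu A g &
    forall n, \int[mu]_(x in A) ((g x - f n x) ^+ 2) <= C * 4 ^- n.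
Proof.
move=> fA Lf Hf.
have mf n : measurable_fun A (f n) by case: (Lf n).
have LB n m : L2 mu A (fun x => f m x - f n x) by exact: L2B.
pose q n x : R := `|f n.+1 x - f n x|.
have mq n : measurable_fun A (fun x => (q n x)%:E).
  apply/measurable_EFinP; apply: measurableT_comp => //.
  exact: measurable_funB.
have q_ge0 n x : (0 <= (q n x)%:E)%E by rewrite lee_fin normr_ge0.
have muA : mu A \is a fin_num by rewrite ge0_fin_numE.
(* Integrating [y <= 2^n * y^2 + 2^-n], where [y] is the n-th increment, bounds its mean by [2^n *
   (C * 4^-n) + mu A * 2^-n = M * 2^-n]. *)
pose M := C + fine (mu A).
have L2n n : L2 mu A (fun=> (2 ^- n : R)).
  by apply: (@bounded_L2 _ _ _ _ _ mA _ (2 ^- n)) => // x _; rewrite ger0_norm.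
have Iq n : (\int[mu]_(x in A) (q n x)%:E <= (M * 2 ^- n)%:E)%E.
  have [_ Id] := LB n n.+1.
  have Iq : mu.-integrable A (EFin \o q n).
    apply: (@integrable_norm _ _ _ mu A (fun x => f n.+1 x - f n x)).
    have := L2M_integrable mA (LB n n.+1) (L2n 0%N).
    by apply: eq_integrable => // x _ /=; rewrite expr0 invr1 mulr1.
  rewrite -(fineK (integrable_fin_num mA Iq)) lee_fin.
  have Ic : mu.-integrable A (EFin \o (fun=> 2 ^- n : R)).
    have := L2M_integrable mA (L2n n) (L2n 0%N).
    by apply: eq_integrable => // x _ /=; rewrite expr0 invr1 mulr1.
  have I2d := integrable_EFinZ mA (2 ^+ n) Id.
  have p2 : (0 : R) < 2 ^+ n by rewrite exprn_gt0.
  apply: (@le_trans _ _ (2 ^+ n * \int[mu]_(x in A) ((f n.+1 x - f n x) ^+ 2)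
      + \int[mu]_(x in A) (2 ^- n))).
    rewrite -(Rintegral_comb mA)//; apply: le_Rintegral => //.
      exact: integrable_EFinD.
    move=> x _; rewrite /q; have := sqr_ge0 (2 ^+ n * `|f n.+1 x - f n x| - 1).
    rewrite -(real_normK (num_real (f n.+1 x - f n x))).
    move: `|_| (normr_ge0 (f n.+1 x - f n x)) => y y0 H.
    rewrite -(ler_pM2l p2) mulrDr divff ?gt_eqF//.
    have := mulr_ge0 (ltW p2) y0; nra.
  rewrite Rintegral_cst// /M mulrDl; apply: lerD; last by rewrite mulrC.
  apply: le_trans (ler_wpM2l (ltW p2) (Hf _ _ (leqnSn n))) _.
  rewrite mulrCA le_eqVlt; apply/orP; left; apply/eqP; congr (_ * _).
  rewrite (_ : 4 = 2 * 2 :> R); last by rewrite -natrM.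
  by rewrite exprMn; field; rewrite gt_eqF.
have S_lty : (\int[mu]_(x in A) (\sum_(n <oo) (q n x)%:E) < +oo)%E.
  rewrite integral_nneseries//.
  apply: (@le_lt_trans _ _ (\sum_(n <oo) (M * 2 ^- n)%:E)%E).
    by apply: lee_nneseries => // n _ _; apply: integral_ge0.
  have E n : (M * 2 ^- n)%:E = (2 * M / (2 ^ (n + 1))%:R)%:E.
    congr EFin; rewrite addn1 expnS natrM natrX; field.
    by rewrite expf_neq0// (pnatr_eq0 R 2).
  under eq_eseriesr do rewrite E.
  have /(cvg_lim (@ereal_hausdorff R)) := @cvg_geometric_eseries_half R (2 * M) 0.
  by rewrite /eseries/= => ->; exact: ltry.
have mS : measurable_fun A (fun x => (\sum_(n <oo) (q n x)%:E)%E).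
  by apply: ge0_emeasurable_sum => // n x _ _; exact: q_ge0.
have IS : mu.-integrable A (fun x => (\sum_(n <oo) (q n x)%:E)%E).
  apply/integrableP; split=> //; rewrite (le_lt_trans _ S_lty)//.
  rewrite le_eqVlt; apply/orP; left; apply/eqP; apply: eq_integral => x _.
  by rewrite gee0_abs// nneseries_ge0.
(* The upper limit exists at every point and is measurable; it agrees with the limit wherever the
   sequence converges. *)
pose g x := fine (limn_esup (fun n => (f n x)%:E)).
have f_cvg : \forall x \ae mu, A x -> f ^~ x @ \oo --> g x.
  apply: filterS (integrable_ae mA IS) => x /[apply] Sx.
  suff /cvg_ex[l fl] : cvgn (f ^~ x).
    have /cvg_limn_einf_sup[_ El] : (f n x)%:E @[n --> \oo] --> l%:E.
      exact: cvg_comp fl _.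
    by rewrite /g El.
  have cq : cvgn (series (fun n => q n x)).
    apply: nondecreasing_is_cvgn.
      by apply: nondecreasing_series => n _; rewrite /q.
    exists (fine (\sum_(n <oo) (q n x)%:E)%E) => _ [k _ <-].
    rewrite -lee_fin fineK// /series/= -sumEFin.
    exact: nneseries_lim_ge.
  have : cvgn (series (telescope (f ^~ x))) by exact: normed_cvg cq.
  move=> /cvg_ex[l Hl]; apply/cvg_ex; exists (f 0%N x + l).
  rewrite (_ : f ^~ x = fun n => f 0%N x + series (telescope (f ^~ x)) n).
    by apply: cvgD => //; exact: cvg_cst.
  by apply/funext => n; exact: (eq_sum_telescope (f ^~ x)).
have mg : measurable_fun A g.
  apply: measurableT_comp => //; apply: measurable_fun_limn_esup => n.
  exact/measurable_EFinP.
have Hg n : (\int[mu]_(x in A) ((g x - f n x) ^+ 2)%:E <= (C * 4 ^- n)%:E)%E.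
  (* The sequence starts at index [n], so that [Hf] bounds the integral of every term in Fatou's
     lemma. *)
  pose u m x := ((f (n + m)%N x - f n x) ^+ 2)%:E.
  have mu_ m : measurable_fun A (u m).
    by apply/measurable_EFinP; apply: measurable_funX; exact: measurable_funB.
  have u0 m x : A x -> (0 <= u m x)%E by rewrite lee_fin sqr_ge0.
  apply: (@le_trans _ _ (\int[mu]_(x in A) limn_einf (u ^~ x))%E).
    apply: ae_ge0_le_integral => //.
    - by move=> x _; rewrite lee_fin sqr_ge0.
    - by apply/measurable_EFinP; apply: measurable_funX; exact: measurable_funB.
    - move=> x Ax; rewrite limn_einf_lim; apply: lime_ge.
        exact: is_cvg_einfs.
      by apply: nearW => m; apply: le_ereal_inf_tmp => _ [k _ <-]; exact: u0.
    - apply: (eq_measurable_fun (fun x => - limn_esup (fun m => - u m x))%E).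
        move=> x _; rewrite -limn_einfN; congr limn_einf.
        by apply/funext => m /=; rewrite opprK.
      apply: measurableT_comp => //; apply: measurable_fun_limn_esup => m.
      exact: measurableT_comp.
    - apply: filterS f_cvg => x /[apply] fg.
      have /cvg_limn_einf_sup[-> _] : u m x @[m --> \oo] --> ((g x - f n x) ^+ 2)%:E.
        apply: cvg_EFin; first exact: nearW.
        rewrite /comp /=; rewrite expr2; under eq_fun do rewrite expr2.
        have fgn : (f (n + m)%N x - f n x) @[m --> \oo] --> g x - f n x.
          apply: cvgB; last exact: cvg_cst.
          move: fg; rewrite -(cvg_shiftn n) /=.
          by under eq_fun do rewrite addnC; apply.
        exact: cvgM.
      exact: lexx.
  apply: le_trans (fatou _ mA mu_ u0) _.
  rewrite limn_einf_lim; apply: lime_le; first exact: is_cvg_einfs.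
  apply: nearW => m; apply: (@le_trans _ _ (\int[mu]_(x in A) u m x)%E).
    by apply: ereal_inf_lbound; exists m => //=.
  have [_ Iu] := LB n (n + m)%N.
  by rewrite /u -(fineK (integrable_fin_num mA Iu)) lee_fin; exact/Hf/leq_addr.
have LgB n : L2 mu A (fun x => g x - f n x).
  split; first exact: measurable_funB.
  apply/integrableP; split.
    by apply/measurable_EFinP; apply: measurable_funX; exact: measurable_funB.
  apply: le_lt_trans (ltry (C * 4 ^- n)); apply: le_trans (Hg n).
  rewrite le_eqVlt; apply/orP; left; apply/eqP; apply: eq_integral => x _.
  by rewrite gee0_abs// lee_fin sqr_ge0.
exists g.
  have := L2D mA (LgB 0%N) (Lf 0%N).
  by under eq_fun do rewrite subrK.
by move=> n; have [_ I] := LgB n; rewrite -lee_fin fineK ?integrable_fin_num.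
Qed.

End square_integrable_complete.

(** * Riesz representation *)

(** The Archimedean property and [n < 4^n]. It stands in for passages to the limit: an identity is
    proved by bounding the square of its defect by [K * 4^-n] for every [n]. *)
Lemma le0_of_le_exp4 (R : archiRealFieldType) (x K : R) :
  (forall n, x <= K * 4 ^- n) -> x <= 0.
Proof.
move=> H; rewrite leNgt; apply/negP => x0.
have K0 : 0 < K by have := H 0%N; rewrite expr0 invr1 mulr1; exact: lt_le_trans.
have [n Hn] : exists n : nat, K / x < n%:R.
  by exists (Num.truncn (K / x)).+1; exact: truncnS_gt.
have n4 : (n%:R : R) <= 4 ^+ n.
  by rewrite -natrX ler_nat ltnW// ltn_expl.
have p4 : (0 : R) < 4 ^+ n by rewrite exprn_gt0.
have := H n; rewrite ler_pdivlMr// leNgt => /negP; apply.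
rewrite ltr_pdivrMr// in Hn; apply: lt_le_trans Hn _.
by rewrite mulrC ler_pM2l.
Qed.

(* Minimizing sequences of [a v v - 2 f v] are Cauchy by the parallelogram
   identity, and their limit solves the Euler equation. *)
Lemma riesz_representation (R : realType) (U : lmodType R) (E : set U)
    (a : U -> U -> R) (f : U -> R) (C : R) :
    E 0 -> (forall c u v, E u -> E v -> E (c *: u + v)) ->
    (forall u v, E u -> E v -> a u v = a v u) ->
    (forall c u v w, E u -> E v -> E w ->
      a (c *: u + v) w = c * a u w + a v w) ->
    (forall u, E u -> 0 <= a u u) ->
    (forall c u v, E u -> E v -> f (c *: u + v) = c * f u + f v) ->
    0 <= C -> (forall u, E u -> f u ^+ 2 <= C * a u u) ->
    (forall (u : U^nat) K, (forall n, E (u n)) ->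
      (forall n m, (n <= m)%N -> a (u m - u n) (u m - u n) <= K * 4 ^- n) ->
      exists2 l, E l & exists K', forall n,
        a (l - u n) (l - u n) <= K' * 4 ^- n) ->
  exists2 u, E u & forall v, E v -> a u v = f v.
Proof.
move=> E0 Elin asym alin apos flin C0 fbnd acomplete.
have alin2 c u v w : E u -> E v -> E w -> a w (c *: u + v) = c * a w u + a w v.
  by move=> Eu Ev Ew; rewrite !(asym w)// ?alin//; exact: Elin.
pose J v := a v v - 2 * f v.
have JE c v u : E u -> E v ->
    J (c *: v + u) = c ^+ 2 * a v v + 2 * (a u v - f v) * c + J u.
  move=> Eu Ev; have Ecvu := Elin c v u Ev Eu.
  rewrite /J flin// alin// !alin2// (asym v u)//; ring.
have J_ge u : E u -> - C <= J u.
  move=> Eu; rewrite /J.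
  have := fbnd _ Eu; have := apos _ Eu.
  move: (a u u) (f u) => x y x0 yC.
  (* Here [4 * y^2 <= 4 * C * x <= (x + C)^2], hence [2 * y <= x + C], which is the lower bound
     [- C] of the energy. *)
  have H : (2 * y) ^+ 2 <= (x + C) ^+ 2 by have := sqr_ge0 (x - C); nra.
  have : 2 * y <= x + C; last lra.
  rewrite leNgt; apply/negP => lt; have xC : 0 <= x + C by lra.
  by move: H; rewrite leNgt ltrXn2r ?nnegrE// lt/= orbT.
pose m := inf [set J v | v in E].
have hasinf : has_inf [set J v | v in E].
  split; first by exists (J 0); exists 0.
  by exists (- C) => _ [u Eu <-]; exact: J_ge.
have m_le v : E v -> m <= J v.
  by move=> Ev; apply: ge_inf; [case: hasinf|exists v].
have /choice[u Hu] n : exists u, E u /\ J u < m + 4 ^- n.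
  have e0 : (0 : R) < 4 ^- n by rewrite invr_gt0 exprn_gt0.
  by have [_ [v Ev <-] Jv] := inf_adherent e0 hasinf; exists v.
have Eu n : E (u n) by case: (Hu n).
have Ju n : J (u n) < m + 4 ^- n by case: (Hu n).
have EB v w : E v -> E w -> E (v - w).
  by move=> Ev Ew; have := Elin (- 1) w v Ew Ev; rewrite scaleN1r addrC.
have [||l El [K' Hl]] := acomplete u 4 => //.
  move=> n k nk.
  have Ed := EB _ _ (Eu k) (Eu n).
  (* The infimum is tested at the midpoint of [u n] and [u k]. A quarter of the energy of
     [u k - u n] is the mean of the two values of [J] minus the value at the midpoint, hence at most
     [4^-n]; this explains the constant 4 passed to [acomplete]. *)
  have h : m <= J (2^-1 *: (u k - u n) + u n) by apply: m_le; exact: Elin.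
  have h1 : J (u k) = J (1 *: (u k - u n) + u n) by rewrite scale1r subrK.
  move: h h1; rewrite !JE//.
  have := Ju k; have := Ju n.
  have le4 : (4 ^- k : R) <= 4 ^- n.
    by rewrite lef_pV2 ?posrE ?exprn_gt0// ler_weXn2l// ler1n.
  move: le4; move: (4 ^- k : R) (4 ^- n : R) (J (u k)) (J (u n)).
  move: (a (u n) _ - f _) (a _ _) => w z e1 e2 x y; rewrite expr1n !exprVn; nra.
exists l => // v Ev; apply/eqP; rewrite -subr_eq0 -sqrf_eq0.
rewrite eq_le sqr_ge0 andbT.
(* The defect is [a (l - u n) v] plus [a (u n) v - f v]. Their squares are at most
   [K' * a v v * 4^-n] and [a v v * 4^-n], and squaring the sum costs a factor 2. *)
apply: (@le0_of_le_exp4 _ _ (2 * (K' + 1) * a v v)) => n.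
(* Moving from [u n] along [v] can lower [J] by at most [4^-n], so the increment of [J] plus [4^-n]
   is a nonnegative quadratic polynomial in [t]. *)
have h1 : (a (u n) v - f v) ^+ 2 <= a v v * 4 ^- n.
  apply: quad_ge0_discr => [|t]; first exact: apos.
  have := m_le _ (Elin t v (u n) Ev (Eu n)); rewrite JE//.
  have := Ju n; move: (4 ^- n : R) => e; lra.
have Ed := EB _ _ El (Eu n).
have h2 : a (l - u n) v ^+ 2 <= a v v * a (l - u n) (l - u n).
  apply: quad_ge0_discr => [|t]; first exact: apos.
  have := apos _ (Elin t v (l - u n) Ev Ed).
  by rewrite alin ?(alin2 t v (l - u n)) ?(asym v (l - u n))//; [nra|exact: Elin].
have -> : a l v = a (l - u n) v + a (u n) v.
  by rewrite -{1}(subrK (u n) l) -{1}(scale1r (l - u n)) alin// mul1r.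
have h3 := ler_wpM2l (apos _ Ev) (Hl n).
move: h1 h2 h3; move: (a (l - u n) (l - u n)) => w.
move: (a (l - u n) v) (a (u n) v) (a v v) (f v) => x y z q h1 h2 h3.
have := sqr_ge0 (x - (y - q)).
by move: (4 ^- n : R) h1 h3 => e h1 h3; nra.
Qed.

(** * Topology and area of the plane *)

Section plane.
Context {R : realType}.
Implicit Types (O : set (R * R)) (q : (R * R) * (R * R)).

Local Notation plane := (measurableTypeR R * measurableTypeR R)%type.

(** Same type as a side of the polygon, read differently: [q.1] and [q.2] are the ranges of the two
    coordinates, not two points. *)
Definition open_rect q : set (R * R) :=
  `]q.1.1, q.1.2[%classic `*` `]q.2.1, q.2.2[%classic.

Definition closed_rect q : set (R * R) :=
  `[q.1.1, q.1.2]%classic `*` `[q.2.1, q.2.2]%classic.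

(** Rational corners make the family countable; keeping the closed rectangle inside [O] later gives
    the bumps compact support in [O]. *)
Lemma open_plane_rect O p : open O -> O p ->
  exists q : (rat * rat) * (rat * rat),
    let q' := ((ratr q.1.1, ratr q.1.2), (ratr q.2.1, ratr q.2.2)) in
    open_rect q' p /\ closed_rect q' `<=` O.
Proof.
move=> oO Op; have /nbhs_ballP[e /= e0 eO] : nbhs p O by exact: open_nbhs_nbhs.
have ex (x : R) : exists r : rat * rat, x - e < ratr r.1 < x /\ x < ratr r.2 < x + e.
  have [r1] : exists r1 : rat, ratr r1 \in `]x - e, x[.
    by apply: rat_in_itvoo; rewrite ltrBlDr ltrDl.
  have [r2] : exists r2 : rat, ratr r2 \in `]x, x + e[.
    by apply: rat_in_itvoo; rewrite ltrDl.
  by rewrite !in_itv /= => H2 H1; exists (r1, r2).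
have [[a b] /= [/andP[a1 a2] /andP[b1 b2]]] := ex p.1.
have [[c d] /= [/andP[c1 c2] /andP[d1 d2]]] := ex p.2.
exists ((a, b), (c, d)); split=> /=.
  by split; rewrite /= in_itv /=; apply/andP.
move=> z [/=]; rewrite !in_itv /= => /andP[z1 z2] /andP[z3 z4].
apply: eO; split; rewrite /ball /= ltr_norml; lra.
Qed.

Lemma open_plane_cover O : open O ->
  exists q : ((R * R) * (R * R))^nat, O = \bigcup_k open_rect (q k) /\
    forall k, closed_rect (q k) `<=` O.
Proof.
move=> oO.
pose r (q : (rat * rat) * (rat * rat)) : (R * R) * (R * R) :=
  ((ratr q.1.1, ratr q.1.2), (ratr q.2.1, ratr q.2.2)).
(* Codes of no rectangle, or of one that leaves [O], get the default [((1, 0), (1, 0))], whose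
   closed rectangle is empty. *)
pose q k := if unpickle k is Some x then
  (if `[< closed_rect (r x) `<=` O >] then r x else ((1, 0), (1, 0)))
  else ((1, 0), (1, 0)).
have e0 : closed_rect ((1, 0), (1, 0)) = set0.
  apply/seteqP; split=> // z [/=]; rewrite in_itv /= => /andP[h1 h2] _.
  by have := le_trans h1 h2; rewrite ler10.
have qO k : closed_rect (q k) `<=` O.
  rewrite /q; case: (unpickle k) => [x|]; last by rewrite e0.
  by case: asboolP => // _; rewrite e0.
exists q; split=> //; apply/seteqP; split=> [p Op|p [k _ [p1 p2]]].
  have [x [xp xO]] := open_plane_rect oO Op.
  exists (pickle x) => //; rewrite /q pickleK.
  by case: asboolP.
by apply: (qO k); split; exact: subset_itv_oo_cc.
Qed.

Lemma measurable_open_rect q : measurable (open_rect q : set plane).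
Proof. by apply: measurableX; exact: measurable_itv. Qed.

Lemma open_plane_measurable O : open O -> measurable (O : set plane).
Proof.
move=> /open_plane_cover[q [-> _]]; apply: bigcup_measurable => k _.
exact: measurable_open_rect.
Qed.

Lemma continuous_plane_measurable (f : R * R -> R) : continuous f ->
  measurable_fun (setT : set plane) f.
Proof.
move=> /continuousP cf; apply: (measurability _ (RGenOInfty.measurableE R)).
move=> _ [_ [x ->] <-]; rewrite setTI.
apply: open_plane_measurable; apply: cf; exact: interval_open.
Qed.

Lemma bounded_plane_rect O : bounded_set O ->
  exists M : R, O `<=` closed_rect ((- M, M), (- M, M)).
Proof.
move=> [M [_ HM]]; exists (M + 1) => p Op.
have : `|p| <= M + 1 by apply: HM => //; rewrite ltrDl.
rewrite prod_normE ge_max => /andP[p1 p2].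
by split; rewrite /= in_itv/= -ler_norml.
Qed.

Lemma closed_rect_compact q : compact (closed_rect q).
Proof. by apply: compact_setX; exact: segment_compact. Qed.

Lemma bounded_plane_area O : open O -> bounded_set O -> (area R O < +oo)%E.
Proof.
move=> oO /bounded_plane_rect[M OM].
have mq : measurable (closed_rect ((- M, M), (- M, M))).
  by apply: measurableX; exact: measurable_itv.
apply: (@le_lt_trans _ _ (area R (closed_rect ((- M, M), (- M, M))))).
  by apply: le_measure => //; rewrite inE//; exact: open_plane_measurable.
rewrite product_measure1E//=; try exact: measurable_itv.
rewrite lebesgue_measure_itv/=; case: ifPn => _; rewrite ?mule0//.
by rewrite -EFinD -EFinM ltry.
Qed.

Lemma continuous_plane_bounded O (f : R * R -> R) : bounded_set O ->
  continuous f -> exists M, forall p, O p -> `|f p| <= M.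
Proof.
move=> /bounded_plane_rect[M OM] cf.
have : compact (f @` closed_rect ((- M, M), (- M, M))).
  apply: continuous_compact; last exact: closed_rect_compact.
  exact: continuous_subspaceT.
move=> /compact_bounded[N [_ HN]]; exists (N + 1) => p Op.
by apply: HN; [rewrite ltrDl|exists p => //; exact: OM].
Qed.

Lemma continuous_plane_L2 O (f : R * R -> R) : open O -> bounded_set O ->
  continuous f -> L2 (area R) O f.
Proof.
move=> oO bO cf; have [M HM] := continuous_plane_bounded bO cf.
have mO := open_plane_measurable oO.
apply: (@bounded_L2 _ _ _ (area R) _ _ _ M) => //; first exact: bounded_plane_area.
apply: measurable_funTS; exact: continuous_plane_measurable.
Qed.

End plane.

(** * Smooth functions of compact support *)

Section flat_function.
Context {R : realType}.
Implicit Types (x y : R) (k n : nat).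

(* The functions x^-k exp(-1/x), extended by 0 to x <= 0, are closed under
   differentiation up to linear combinations; flat 0 is the building block of the
   test functions. *)
Definition flat k x : R := if 0 < x then x^-1 ^+ k * expR (- x^-1) else 0.

Lemma flat_ge0 k x : 0 <= flat k x.
Proof.
rewrite /flat; case: ifPn => // x0.
by rewrite mulr_ge0 ?expR_ge0// exprn_ge0// invr_ge0 ltW.
Qed.

Lemma flat_le0 k x : x <= 0 -> flat k x = 0.
Proof. by rewrite /flat ltNge => ->. Qed.

Lemma flat0_le1 x : flat 0 x <= 1.
Proof.
rewrite /flat; case: ifPn => // x0.
by rewrite expr0 mul1r -expR0 ler_expR oppr_le0 invr_ge0 ltW.
Qed.

(** From [y^(k+1) / (k+1)! <= exp y] at [y = 1/x]. Applied to the difference quotient of [flat] at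
    0, it gives derivative 0 there. *)
Lemma flat_linear_bound k x : `|flat k x| <= k.+1`!%:R * `|x|.
Proof.
rewrite ger0_norm ?flat_ge0// /flat; case: ifPn => [x0|_]; last first.
  by rewrite mulr_ge0.
have Vx0 : 0 <= x^-1 by rewrite invr_ge0 ltW.
have f0 : (0 : R) < (k.+1)`!%:R by rewrite ltr0n fact_gt0.
rewrite gtr0_norm// expRN ler_pdivrMr ?expR_gt0//.
have H : x^-1 ^+ k.+1 / k.+1`!%:R <= expR x^-1.
  by apply: le_trans (expR_ge1Dxn k Vx0); rewrite lerDr.
have := ler_wpM2l (ltW (mulr_gt0 f0 x0)) H; apply: le_trans.
rewrite le_eqVlt; apply/orP; left; apply/eqP.
by rewrite exprS; field; rewrite !gt_eqF.
Qed.

Lemma is_derive_flat k x :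
  is_derive x 1 (flat k) (flat k.+2 x - k%:R * flat k.+1 x).
Proof.
have [x0|x0|->] := ltgtP x 0.
- rewrite !flat_le0 ?ltW// mulr0 subr0.
  apply: (@near_eq_is_derive _ _ _ (cst 0)) => //.
    have : nbhs x [set y | y < 0].
      by apply: open_nbhs_nbhs; split => //; exact: open_lt.
    by apply: filterS => y /= y0; rewrite flat_le0// ltW.
- have xn0 : x != 0 by rewrite gt_eqF.
  apply: (@near_eq_is_derive _ _ _
      ((fun y => (id y)^-1) ^+ k * (expR \o - (fun y : R => (id y)^-1)))).
    have : nbhs x [set y | 0 < y].
      by apply: open_nbhs_nbhs; split => //; exact: open_gt.
    apply: filterS => y /= y0; rewrite /flat y0.
    by rewrite -[LHS]/((((fun y => y^-1) ^+ k) y) * expR (- y^-1)) fctE.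
  have dV : is_derive x 1 (fun y : R => (id y)^-1) (- (id x) ^- 2 *: 1).
    exact: is_deriveV.
  apply: is_derive_eq; rewrite /flat x0 !fctE /= /GRing.scale /= mulr1.
  by case: k => [|k]; rewrite ?mul0r /= !exprS ?expr0; field.
- have lim0 : (fun t => t^-1 *: ((flat k \o shift 0) (t *: 1) - flat k 0))
      @ 0^' --> (0 : R).
    apply/cvgr0Pnorm_le => e e0.
    have f0 : (0 : R) < (k.+2)`!%:R by rewrite ltr0n fact_gt0.
    exists (e / (k.+2)`!%:R) => /=; first by rewrite divr_gt0.
    move=> t /=; rewrite sub0r normrN ltr_pdivlMr// => te tn0.
    rewrite /= addr0 (flat_le0 k (lexx 0)) subr0 /GRing.scale /= mulr1.
    (* The difference quotient at 0 belongs to the same family, one order higher, so the linear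
       bound sends it to 0. *)
    have -> : t^-1 * flat k t = flat k.+1 t.
      by rewrite /flat; case: ifPn => _; rewrite ?mulr0// exprS mulrA.
    by apply: le_trans (flat_linear_bound _ _) _; rewrite mulrC ltW.
  rewrite !flat_le0// mulr0 subr0; apply: DeriveDef; last exact: cvg_lim.
  by apply/cvg_ex; exists 0.
Qed.

End flat_function.

Section smooth_functions.
Context {R : realType}.
Implicit Types (phi psi : R * R -> R) (p : R * R) (i j : 'I_2) (n k : nat).

(** Finite-order smoothness, by recursion on the order: the product rule lowers the order by one, so
    stability under products is an induction on [n], which the lists of directions in [smooth] do
    not offer directly. *)
Fixpoint Cn n phi : Prop := continuous phi /\
  if n is m.+1 then
    forall i, (forall p, derivable phi p (axis i)) /\ Cn m (partial i phi)
  else True.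

Lemma CnS n phi : Cn n.+1 phi -> Cn n phi.
Proof.
elim: n phi => [|n IH] phi; first by case.
case=> cphi H; split=> // i; have [dphi Hi] := H i.
by split=> //; exact: IH.
Qed.

Lemma CnP phi : (forall n, Cn n phi) -> smooth phi.
Proof.
move=> H s; have {H} := H (size s).+1.
(* [foldr] applies the last direction of the list first, and this is the derivative that [Cn] peels
   off. *)
elim/last_ind: s phi => [|s i IH] phi /=.
  by case=> cphi Hi; split=> // i; case: (Hi i).
by rewrite size_rcons foldr_rcons => -[_ /(_ i)[_ /IH]].
Qed.

Lemma partialD i phi psi : (forall p, derivable phi p (axis i)) ->
  (forall p, derivable psi p (axis i)) ->
  partial i (fun p => phi p + psi p) = fun p => partial i phi p + partial i psi p.
Proof. by move=> d1 d2; apply/funext => p; rewrite /partial deriveD. Qed.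

Lemma partialM i phi psi : (forall p, derivable phi p (axis i)) ->
  (forall p, derivable psi p (axis i)) ->
  partial i (fun p => phi p * psi p) =
  fun p => phi p * partial i psi p + psi p * partial i phi p.
Proof. by move=> d1 d2; apply/funext => p; rewrite /partial deriveM. Qed.

Lemma continuous_planeD phi psi : continuous phi -> continuous psi ->
  continuous (fun p => phi p + psi p).
Proof. by move=> c1 c2 p; apply: cvgD; [exact: c1|exact: c2]. Qed.

Lemma continuous_planeM phi psi : continuous phi -> continuous psi ->
  continuous (fun p => phi p * psi p).
Proof. by move=> c1 c2 p; apply: cvgM; [exact: c1|exact: c2]. Qed.

Lemma CnD n phi psi : Cn n phi -> Cn n psi -> Cn n (fun p => phi p + psi p).
Proof.
elim: n phi psi => [|n IH] phi psi [c1 H1] [c2 H2]; split=> //;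
  try exact: continuous_planeD.
move=> i; have [d1 {}H1] := H1 i; have [d2 {}H2] := H2 i; split.
  by move=> p; exact: derivableD.
by rewrite partialD//; exact: IH.
Qed.

Lemma CnM n phi psi : Cn n phi -> Cn n psi -> Cn n (fun p => phi p * psi p).
Proof.
elim: n phi psi => [|n IH] phi psi.
  by case=> c1 _ [c2 _]; split=> //; exact: continuous_planeM.
move=> K1 K2; have [c1 H1] := K1; have [c2 H2] := K2; split.
  exact: continuous_planeM.
move=> i; have [d1 {}H1] := H1 i; have [d2 {}H2] := H2 i; split.
  by move=> p; exact: derivableM.
by rewrite partialM//; apply: CnD; apply: IH => //; exact: CnS.
Qed.

Lemma partial_cst i (c : R) : partial i (fun=> c) = fun=> 0.
Proof. by apply/funext => p; exact: derive_cst. Qed.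

Lemma Cn_cst n (c : R) : Cn n (fun=> c).
Proof.
elim: n c => [|n IH] c; first by split=> // p; exact: cvg_cst.
split; first by move=> p; exact: cvg_cst.
by move=> i; split=> [p|]; [exact: derivable_cst|rewrite partial_cst].
Qed.

Lemma smooth_comb (c : R) phi psi : smooth phi -> smooth psi ->
  smooth (c *: phi + psi).
Proof.
move=> sphi spsi s.
have -> : foldr partial (c *: phi + psi) s =
    c *: foldr partial phi s + foldr partial psi s.
  elim: s => //= i s ->; apply/funext => p.
  rewrite /partial deriveD;
    [|by apply: derivableZ; case: (sphi s)|by case: (spsi s)].
  by rewrite deriveZ//; case: (sphi s).
move=> g; have [c1 d1] := sphi s; have [c2 d2] := spsi s; split.
  move=> p; apply: cvgD; last exact: c2.
  by apply: cvgZr; exact: c1.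
by move=> i p; apply: derivableD => //; exact: derivableZ.
Qed.

Lemma smooth0 : smooth (0 : R * R -> R).
Proof. by apply: CnP => n; exact: Cn_cst. Qed.

Lemma smooth_continuous phi : smooth phi -> continuous phi.
Proof. by move=> /(_ [::])[]. Qed.

Lemma smooth_partial_continuous i phi : smooth phi ->
  continuous (partial i phi).
Proof. by move=> /(_ [:: i])[]. Qed.

Definition coord i p : R := if i == 0 then p.1 else p.2.

Lemma coord_continuous i : continuous (coord i).
Proof.
have -> : coord i = if i == 0 then fst else snd.
  by apply/funext => p; rewrite /coord; case: ifP.
by case: ifP => _ p; [exact: cvg_fst|exact: cvg_snd].
Qed.

Lemma coordD i j h p : coord i (h *: axis j + p) = h * (i == j)%:R + coord i p.
Proof.
by rewrite /coord /axis; case: i => -[|[|i]] // lti; case: j => -[|[|j]] // ltj.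
Qed.

(** Along [axis j] the difference quotient of [F \o coord i] is the one-variable quotient of [F] if
    [i = j], and is constantly 0 otherwise. *)
Lemma is_derive_coord i j (F : R -> R) (dF : R) p :
  is_derive (coord i p) 1 F dF ->
  is_derive p (axis j) (F \o coord i) (if i == j then dF else 0).
Proof.
move=> [dvF EF].
pose g h := h^-1 *: ((F \o shift (coord i p)) (h *: 1) - F (coord i p)).
have E : (fun h : R =>
    h^-1 *: ((F \o coord i \o shift p) (h *: axis j) - (F \o coord i) p)) =
    if i == j then g else fun=> 0.
  apply/funext => h; rewrite /g /= coordD; case: ifP => ij.
    by rewrite /= /GRing.scale /=.
  by rewrite mulr0 add0r subrr scaler0.
case: ifP E => ij E.
  by apply: DeriveDef; rewrite /derivable ?/derive E.
apply: DeriveDef; rewrite /derivable ?/derive E; first exact: is_cvg_cst.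
exact: lim_cst.
Qed.

Definition flat_affine k i (a b : R) p : R := flat k (a * coord i p + b).

Lemma flat_continuous k : continuous (@flat R k).
Proof.
move=> x; apply: differentiable_continuous; apply/derivable1_diffP.
by have [] := is_derive_flat k x.
Qed.

(** The induction on [n] keeps [k] general, since a derivative of order [k] involves the orders
    [k.+1] and [k.+2]. *)
Lemma Cn_flat n k i a b : Cn n (flat_affine k i a b).
Proof.
have cf m : continuous (flat_affine m i a b).
  move=> p; apply: (@continuous_comp _ _ _ (fun p => a * coord i p + b)).
    apply: cvgD; last exact: cvg_cst.
    by apply: cvgMr; exact: coord_continuous.
  exact: flat_continuous.
elim: n k => [|n IH] k; split=> // j.
have D p : is_derive p (axis j) (flat_affine k i a b)
    (if i == j then
       (flat_affine k.+2 i a b p - k%:R * flat_affine k.+1 i a b p) * a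
     else 0).
  apply: (@is_derive_coord i j (flat k \o (fun x => a * x + b))).
  apply: is_derive1_comp; first exact: is_derive_flat.
  have := is_deriveD (is_deriveZ a (is_derive_id (coord i p) 1))
    (is_derive_cst b (coord i p) 1).
  by rewrite addr0 /GRing.scale /= mulr1.
split; first by move=> p; case: (D p).
have -> : partial j (flat_affine k i a b) =
    if i == j then
      (fun p => (flat_affine k.+2 i a b p + (- k%:R) * flat_affine k.+1 i a b p) * a)
    else fun=> 0.
  apply/funext => p; case: (D p) => _; rewrite /partial => ->.
  by case: ifP => // _; rewrite mulNr.
case: ifP => _; last exact: Cn_cst.
by apply: CnM; [apply: CnD => //; apply: CnM => //|]; exact: Cn_cst.
Qed.

End smooth_functions.

(** * The fundamental lemma of the calculus of variations *)

Section fundamental_lemma.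
Context {R : realType}.
Implicit Types (O : set (R * R)) (q : (R * R) * (R * R)) (g : R * R -> R).

Local Notation plane := (measurableTypeR R * measurableTypeR R)%type.

(** A generating family stable under intersection, chosen because a ray cuts an open interval in an
    open interval with the same right end. [setT] is included so that cylinders over rays are
    [quadrants]. *)
Definition rays : set (set R) :=
  [set A | A = setT \/ exists x, A = `]x, +oo[%classic].

Lemma rays_setI : setI_closed rays.
Proof.
move=> A B [->|[x ->]] [->|[y ->]]; rewrite ?setTI ?setIT.
- by left.
- by right; exists y.
- by right; exists x.
right; exists (Num.max x y); apply/seteqP; split=> z /=.
  by rewrite !in_itv/= !andbT gt_max => -[-> ->].
by rewrite !in_itv/= !andbT gt_max => /andP[-> ->].
Qed.

Lemma rays_itv A (a b : R) : rays A -> exists2 a' : R, a <= a' &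
  A `&` `]a, b[%classic = `]a', b[%classic.
Proof.
move=> [->|[x ->]]; first by exists a; rewrite ?setTI.
exists (Num.max x a); first by rewrite le_max lexx orbT.
apply/seteqP; split=> z /=; rewrite !in_itv/= ?andbT gt_max.
  by move=> [-> /andP[-> ->]].
by move=> /andP[/andP[-> ->] ->].
Qed.

Lemma raysE : @measurable _ (measurableTypeR R) = <<s rays >>.
Proof.
apply/seteqP; split.
  rewrite [X in X `<=` _]RGenOInfty.measurableE.
  by apply: sub_sigma_algebra2 => A; right.
apply: smallest_sub; first exact: sigma_algebra_measurable.
by move=> A [->|[x ->]]; [exact: measurableT|exact: measurable_itv].
Qed.

Definition quadrants : set (set plane) := [set A `*` B | A in rays & B in rays].

(** A product [A * B] of Borel sets is the intersection of two preimages under the projections,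
    which are measurable for the generated sigma-algebra because cylinders over rays are
    quadrants. *)
Lemma quadrantsE : @measurable _ plane = <<s quadrants >>.
Proof.
rewrite measurable_prod_measurableType; apply/seteqP; split; last first.
  apply: sub_sigma_algebra2 => _ [A rA [B rB <-]].
  have mrays C : rays C -> measurable (C : set (measurableTypeR R)).
    by move=> rC; rewrite raysE; exact: sub_sigma_algebra.
  by exists A; [exact: mrays|exists B; [exact: mrays|]].
apply: smallest_sub; first exact: smallest_sigma_algebra.
have m1 : measurable_fun (setT : set (g_sigma_algebraType quadrants))
    (fst : _ -> measurableTypeR R).
  apply: (measurability _ raysE) => _ [A rA <-]; rewrite setTI.
  apply: sub_sigma_algebra; exists A => //; exists setT; first by left.
  by apply/seteqP; split=> z //= [].
have m2 : measurable_fun (setT : set (g_sigma_algebraType quadrants))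
    (snd : _ -> measurableTypeR R).
  apply: (measurability _ raysE) => _ [A rA <-]; rewrite setTI.
  apply: sub_sigma_algebra; exists setT; first by left.
  by exists A => //; apply/seteqP; split=> z //= [].
move=> _ [A mA [B mB <-]].
have := measurableI _ _ (m1 measurableT _ mA) (m2 measurableT _ mB).
by rewrite !setTI.
Qed.

Lemma quadrants_setI : setI_closed quadrants.
Proof.
move=> _ _ [A rA [B rB <-]] [A' rA' [B' rB' <-]]; rewrite -setXI.
by exists (A `&` A'); [exact: rays_setI|exists (B `&` B'); [exact: rays_setI|]].
Qed.

(** The sets [S] for which [g] has integral 0 over the part of [S] in the rectangle form a Dynkin
    class. It contains the quadrants, which cut the rectangle in smaller ones, hence all measurable
    sets; an integrable function with zero integral over every measurable subset vanishes almost
    everywhere. *)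
Lemma ae_eq0_on_rect q g :
    (area R).-integrable (open_rect q) (EFin \o g) ->
    (forall q', closed_rect q' `<=` closed_rect q ->
      (\int[area R]_(p in open_rect q') (g p)%:E = 0)%E) ->
  ae_eq (area R) (open_rect q) g (fun=> 0).
Proof.
move=> Ig H; have mQ := @measurable_open_rect R q.
pose P (S : set plane) := (\int[area R]_(p in S `&` open_rect q) (g p)%:E = 0)%E.
have IgS (S : set plane) : measurable S ->
    (area R).-integrable (S `&` open_rect q) (EFin \o g).
  by move=> mS; apply: integrableS Ig => //; exact: measurableI.
have PT : P setT by rewrite /P setTI; exact: H.
have PG : quadrants `<=` P.
  move=> _ [A rA [B rB <-]]; rewrite /P /open_rect -setXI.
  have [a ale ->] := rays_itv q.1.1 q.1.2 rA.
  have [b ble ->] := rays_itv q.2.1 q.2.2 rB.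
  apply: (H ((a, q.1.2), (b, q.2.2))) => p [/=].
  rewrite !in_itv/= => /andP[p1 p2] /andP[p3 p4].
  by split; rewrite /= in_itv/= ?p2 ?p4 andbT;
    [exact: le_trans p1|exact: le_trans p3].
have Pall S : measurable (S : set plane) -> P S.
  rewrite quadrantsE; apply: (dynkin_induction quadrantsE quadrants_setI PT PG).
    move=> {}S mS PS.
    have := PT; rewrite /P -(setvU S) setIUl integral_setU//.
    - by rewrite PS adde0.
    - by apply: measurableI => //; exact: measurableC.
    - exact: measurableI.
    - rewrite -setIUl setvU setTI; exact: measurable_int Ig.
    - by apply/disj_setPS => p [[nS _] [pS _]].
  move=> F mF tF PF; rewrite /P setI_bigcupl integral_bigcup//.
  - by rewrite eseries0// => i _ _; exact: PF.
  - by apply: trivIset_setIr.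
  - by move=> k; exact: measurableI.
  - by rewrite -setI_bigcupl; apply: IgS; exact: bigcupT_measurable.
have := @integral_ae_eq _ _ _ (area R) _ mQ (cst 0%E) _ Ig.
case=> //.
- by move=> E EQ mE; rewrite integral0 -[RHS](Pall _ mE) (setIidl EQ).
- move=> N [mN N0 NE]; exists N; split=> // p /= Hp; apply: NE => /= Hp'.
  by apply: Hp => /Hp'[].
Qed.

(** One factor per side of the rectangle. Since [exp (- 1 / (n x))] tends to 1 for [x > 0], the
    bumps tend to the indicator of the open rectangle while staying between 0 and 1. *)
Definition bump q n : R * R -> R := fun p =>
  flat_affine 0 0 n.+1%:R (- n.+1%:R * q.1.1) p *
  flat_affine 0 0 (- n.+1%:R) (n.+1%:R * q.1.2) p *
  (flat_affine 0 1 n.+1%:R (- n.+1%:R * q.2.1) p *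
   flat_affine 0 1 (- n.+1%:R) (n.+1%:R * q.2.2) p).

Lemma smooth_bump q n : smooth (bump q n).
Proof. by apply: CnP => m; do ![apply: CnM]; exact: Cn_flat. Qed.

Lemma bumpE q n p : bump q n p =
  flat 0 (n.+1%:R * (p.1 - q.1.1)) * flat 0 (n.+1%:R * (q.1.2 - p.1)) *
  (flat 0 (n.+1%:R * (p.2 - q.2.1)) * flat 0 (n.+1%:R * (q.2.2 - p.2))).
Proof.
by rewrite /bump /flat_affine /coord /=; do ![congr (_ * _)]; congr flat; ring.
Qed.

Lemma bump_ge0 q n p : 0 <= bump q n p.
Proof. by rewrite bumpE !mulr_ge0// flat_ge0. Qed.

Lemma bump_le1 q n p : bump q n p <= 1.
Proof.
by rewrite bumpE !mulr_ile1 ?mulr_ge0 ?flat_ge0// flat0_le1.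
Qed.

Lemma bump_out q n p : ~ open_rect q p -> bump q n p = 0.
Proof.
move=> npq; rewrite bumpE.
have E (a : R) : a <= 0 -> flat 0 (n.+1%:R * a) = 0.
  by move=> a0; rewrite flat_le0// mulr_ge0_le0.
have [h|h1] := leP (p.1 - q.1.1) 0; first by rewrite (E _ h) !mul0r.
have [h|h2] := leP (q.1.2 - p.1) 0; first by rewrite (E _ h) mulr0 mul0r.
have [h|h3] := leP (p.2 - q.2.1) 0; first by rewrite (E _ h) mul0r mulr0.
have [h|h4] := leP (q.2.2 - p.2) 0; first by rewrite (E _ h) !mulr0.
by case: npq; split; rewrite /= in_itv/=; lra.
Qed.

Lemma flat0_cvg1 (x : R) : 0 < x ->
  (fun n => flat 0 (n.+1%:R * x)) @ \oo --> (1 : R).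
Proof.
move=> x0; rewrite -[X in _ --> X]expR0.
rewrite (_ : (fun n => _) = expR \o (fun n => - (x^-1 * n.+1%:R^-1))); last first.
  apply/funext => n; rewrite /flat mulr_gt0// expr0 mul1r /= invfM mulrC//.
have : (fun n => - (x^-1 * n.+1%:R^-1)) @ \oo --> (0 : R).
  rewrite -[X in _ --> X]oppr0 -[X in _ --> - X](mulr0 x^-1).
  apply: cvgN; apply: cvgMr; exact: cvg_harmonic.
move=> /cvg_comp; apply; exact: continuous_expR.
Qed.

Lemma bump_cvg1 q p : open_rect q p -> bump q ^~ p @ \oo --> (1 : R).
Proof.
move=> [/=]; rewrite !in_itv/= => /andP[h1 h2] /andP[h3 h4].
rewrite (_ : bump q ^~ p = (fun n =>
  flat 0 (n.+1%:R * (p.1 - q.1.1)) * flat 0 (n.+1%:R * (q.1.2 - p.1)) *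
  (flat 0 (n.+1%:R * (p.2 - q.2.1)) * flat 0 (n.+1%:R * (q.2.2 - p.2))))).
  have E : (1 : R) = 1 * 1 * (1 * 1) by rewrite !mulr1.
  rewrite [X in _ --> X]E.
  by apply: cvgM; apply: cvgM; apply: flat0_cvg1; rewrite subr_gt0.
by apply/funext => n; rewrite bumpE.
Qed.

Lemma test_function_bump O q n : closed_rect q `<=` O ->
  test_function O (bump q n).
Proof.
move=> qO; split; first exact: smooth_bump.
exists (closed_rect q); split=> //; first exact: closed_rect_compact.
move=> p npq; apply: bump_out => -[p1 p2]; apply: npq.
by split; exact: subset_itv_oo_cc.
Qed.

(** Dominated convergence along the bumps, with bound [|g|], turns the hypothesis into zero
    integrals over all rectangles in [O]; a countable cover by rectangles then joins the null sets.
    As [O] has finite area, [g] is integrable. *)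
Lemma test_function_ae_eq0 O g : open O -> bounded_set O ->
  L2 (area R) O g ->
  (forall phi, test_function O phi -> \int[area R]_(p in O) (g p * phi p) = 0) ->
  ae_eq (area R) O g (fun=> 0).
Proof.
move=> oO bO Lg H.
have mO : measurable (O : set plane) by exact: open_plane_measurable.
have L1 : L2 (area R) O (fun=> 1).
  by apply: continuous_plane_L2 => // p; exact: cvg_cst.
have Ig : (area R).-integrable O (EFin \o g).
  have := L2M_integrable mO Lg L1.
  by apply: eq_integrable => // p _ /=; rewrite mulr1.
have sub q : closed_rect q `<=` O -> open_rect q `<=` O.
  move=> qO p [p1 p2]; apply: qO.
  by split; exact: subset_itv_oo_cc.
have I0 q : closed_rect q `<=` O ->
    (\int[area R]_(p in open_rect q) (g p)%:E = 0)%E.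
  move=> qO; rewrite -(setIidr (sub _ qO)) integral_mkcondr.
  have mg := L2_measurable Lg.
  have mQ := @measurable_open_rect R q.
  have [] := @dominated_convergence _ plane R (area R) O mO
    (fun n p => (g p * bump q n p)%:E) ((EFin \o g) \_ (open_rect q))
    (fun p => `|g p|%:E).
  - move=> n; apply/measurable_EFinP; apply: measurable_funM => //.
    apply: measurable_funTS; apply: continuous_plane_measurable.
    exact: smooth_continuous (smooth_bump _ _).
  - apply/(measurable_restrict _ _ _).1 => //.
    apply: measurable_funS (measurable_int _ Ig) => //; exact: subIsetr.
  - apply: aeW => p Op; rewrite patchE; case: ifPn => pq.
      apply: cvg_EFin; first exact: nearW.
      rewrite -[X in _ --> X]mulr1; apply: cvgMr.
      by apply: bump_cvg1; rewrite inE in pq.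
    apply: cvg_near_cst; apply: nearW => n; rewrite bump_out ?mulr0//.
    by rewrite notin_setE in pq.
  - exact: integrable_norm Ig.
  - apply: aeW => p n Op; rewrite abse_EFin lee_fin normrM.
    by rewrite ler_piMr// ger0_norm ?bump_ge0// bump_le1.
  move=> Ilim _; set l := (\int[_]_(x in _) _)%E => hl.
  have E n : (\int[area R]_(p in O) (g p * bump q n p)%:E = 0)%E.
    have Lb : L2 (area R) O (bump q n).
      apply: continuous_plane_L2 => //.
      exact: smooth_continuous (smooth_bump _ _).
    have Igb := L2M_integrable mO Lg Lb.
    rewrite -(fineK (integrable_fin_num mO Igb)).
    by congr EFin; exact: (H _ (test_function_bump n qO)).
  move: hl; rewrite (_ : [sequence _]_n = cst 0%E); last exact/funext.
  by move=> /(cvg_unique (@ereal_hausdorff R)); apply; exact: cvg_cst.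
have [q [OE qO]] := open_plane_cover oO.
have Hk k : ae_eq (area R) (open_rect (q k)) g (fun=> 0).
  apply: ae_eq0_on_rect.
    by apply: integrableS Ig => //; [exact: measurable_open_rect|exact: sub].
  by move=> q' q'q; apply: I0 => p /q'q /qO.
apply: filterS (ae_foralln Hk) => p Hp; rewrite OE => -[k _ pk].
exact: Hp pk.
Qed.

End fundamental_lemma.

(** * Weak derivatives, traces and the space V *)

Section sobolev.
Context {R : realType}.
Variables (Om : set (R * R)) (oO : open Om) (bO : bounded_set Om).
Implicit Types (u v g h phi : R * R -> R) (i : 'I_2) (c : R).

Let mO := open_plane_measurable oO.

Lemma test_function_L2 phi : test_function Om phi -> L2 (area R) Om phi.
Proof.
by move=> [sphi _]; apply: continuous_plane_L2 => //; exact: smooth_continuous.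
Qed.

Lemma partial_test_function_L2 i phi : test_function Om phi ->
  L2 (area R) Om (partial i phi).
Proof.
move=> [sphi _]; apply: continuous_plane_L2 => //.
exact: smooth_partial_continuous.
Qed.

Lemma weak_partial_unique i u g h : L2 (area R) Om g -> L2 (area R) Om h ->
  weak_partial Om i u g -> weak_partial Om i u h -> ae_eq (area R) Om g h.
Proof.
move=> Lg Lh wg wh.
have : ae_eq (area R) Om (fun p => g p - h p) (fun=> 0).
  apply: (test_function_ae_eq0 oO bO (L2B mO Lg Lh)) => phi tphi.
  have Lphi := test_function_L2 tphi.
  under eq_Rintegral do rewrite mulrBl.
  rewrite RintegralB//; try exact: (L2M_integrable mO).
  by apply/eqP; rewrite subr_eq0 -eqr_opp -wg// -wh.
by apply: filterS => p H Op; apply/eqP; rewrite -subr_eq0 H.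
Qed.

(** Of the choice made by [xget] only the defining property is known, so computing [wderiv] means
    exhibiting a candidate and invoking uniqueness. *)
Lemma wderiv_ae_eq i u g : L2 (area R) Om g -> weak_partial Om i u g ->
  ae_eq (area R) Om (wderiv Om i u) g.
Proof.
move=> Lg wg.
have [L w] : L2 (area R) Om (wderiv Om i u) /\ weak_partial Om i u (wderiv Om i u).
  by rewrite /wderiv; case: xgetP => [_ -> //|/(_ g)[]].
exact: weak_partial_unique w wg.
Qed.

Lemma H1_L2 u : H1 Om u -> L2 (area R) Om u.
Proof. by case. Qed.

Lemma wderivP i u : H1 Om u ->
  L2 (area R) Om (wderiv Om i u) /\ weak_partial Om i u (wderiv Om i u).
Proof.
move=> [_ /(_ i)[g Lg wg]]; rewrite /wderiv.
by case: xgetP => [_ -> //|/(_ g)[]].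
Qed.

Lemma wderiv_L2 i u : H1 Om u -> L2 (area R) Om (wderiv Om i u).
Proof. by case/(wderivP i). Qed.

Lemma weak_partial_comb i c u v g h : L2 (area R) Om u -> L2 (area R) Om v ->
  L2 (area R) Om g -> L2 (area R) Om h ->
  weak_partial Om i u g -> weak_partial Om i v h ->
  weak_partial Om i (fun p => c * u p + v p) (fun p => c * g p + h p).
Proof.
move=> Lu Lv Lg Lh wg wh phi tphi.
have Lphi := test_function_L2 tphi; have Ldphi := partial_test_function_L2 i tphi.
under eq_Rintegral do rewrite mulrDl -mulrA.
rewrite (Rintegral_comb mO); try exact: (L2M_integrable mO).
under [in RHS]eq_Rintegral do rewrite mulrDl -mulrA.
rewrite (Rintegral_comb mO); try exact: (L2M_integrable mO).
by rewrite wg// wh// opprD mulrN.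
Qed.

Lemma wderiv_comb i c u v : H1 Om u -> H1 Om v ->
  ae_eq (area R) Om (wderiv Om i (fun p => c * u p + v p))
    (fun p => c * wderiv Om i u p + wderiv Om i v p).
Proof.
move=> Hu Hv; have [Lu wu] := wderivP i Hu; have [Lv wv] := wderivP i Hv.
apply: wderiv_ae_eq; first by apply: L2D => //; exact: L2Z.
by apply: weak_partial_comb => //; exact: H1_L2.
Qed.

Lemma H1_comb c u v : H1 Om u -> H1 Om v -> H1 Om (fun p => c * u p + v p).
Proof.
move=> Hu Hv; split.
  by apply: L2D => //; [apply: L2Z => //|]; exact: H1_L2.
move=> i; have [Lu wu] := wderivP i Hu; have [Lv wv] := wderivP i Hv.
exists (fun p => c * wderiv Om i u p + wderiv Om i v p).
  by apply: L2D => //; exact: L2Z.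
by apply: weak_partial_comb => //; exact: H1_L2.
Qed.

Lemma weak_partial0 i : weak_partial Om i (fun=> 0) (fun=> 0).
Proof.
move=> phi tphi; under eq_Rintegral do rewrite mul0r.
by under [in RHS]eq_Rintegral do rewrite mul0r; rewrite Rintegral_cst// mul0r oppr0.
Qed.

Lemma H10 : H1 Om (fun=> 0).
Proof.
split; first exact: L20.
by move=> i; exists (fun=> 0); [exact: L20|exact: weak_partial0].
Qed.

Lemma oppr_comb u v : (fun p => - 1 * v p + u p) = (fun p => u p - v p).
Proof. by apply/funext => p; rewrite mulN1r addrC. Qed.

Lemma H1B u v : H1 Om u -> H1 Om v -> H1 Om (fun p => u p - v p).
Proof.
by move=> Hu Hv; rewrite -oppr_comb; exact: H1_comb.
Qed.

(** The quantity under the root in [H1norm]; working with squares keeps all estimates additive over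
    the function and its derivatives. *)
Definition H1sq u : R := \int[area R]_(p in Om) (u p ^+ 2) +
  \sum_(i < 2) \int[area R]_(p in Om) (wderiv Om i u p ^+ 2).

Lemma sqr_Rintegral_ge0 g : 0 <= \int[area R]_(p in Om) (g p ^+ 2).
Proof. by apply: Rintegral_ge0 => p _; exact: sqr_ge0. Qed.

Lemma H1sq_ge0 u : 0 <= H1sq u.
Proof.
by rewrite addr_ge0 ?sqr_Rintegral_ge0// sumr_ge0// => i _; exact: sqr_Rintegral_ge0.
Qed.

Lemma H1norm_sqr u : H1norm Om u ^+ 2 = H1sq u.
Proof. by rewrite sqr_sqrtr//; exact: H1sq_ge0. Qed.

Lemma sqr_Rintegral_ae_eq g h : L2 (area R) Om g -> L2 (area R) Om h ->
  ae_eq (area R) Om g h ->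
  \int[area R]_(p in Om) (g p ^+ 2) = \int[area R]_(p in Om) (h p ^+ 2).
Proof.
move=> [mg _] [mh _] gh; apply: Rintegral_ae_eq => //; try exact: measurable_funX.
by apply: filterS gh => p H Op; rewrite H.
Qed.

Lemma H1sqE u (g : 'I_2 -> R * R -> R) : H1 Om u ->
  (forall i, L2 (area R) Om (g i)) ->
  (forall i, ae_eq (area R) Om (wderiv Om i u) (g i)) ->
  H1sq u = \int[area R]_(p in Om) (u p ^+ 2) +
    \sum_(i < 2) \int[area R]_(p in Om) (g i p ^+ 2).
Proof.
move=> Hu Lg ug; congr (_ + _); apply: eq_bigr => i _.
by apply: sqr_Rintegral_ae_eq => //; exact: wderiv_L2.
Qed.

Lemma sqr_Rintegral_comb_le c g h : L2 (area R) Om g -> L2 (area R) Om h ->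
  \int[area R]_(p in Om) ((c * g p + h p) ^+ 2) <=
  2 * c ^+ 2 * \int[area R]_(p in Om) (g p ^+ 2) +
  2 * \int[area R]_(p in Om) (h p ^+ 2).
Proof.
move=> Lg Lh; apply: le_trans (L2_sqr_add_le mO (L2Z mO c Lg) Lh) _.
under eq_Rintegral do rewrite exprMn.
by rewrite RintegralZl ?mulrA//; case: Lg.
Qed.

Lemma H1sq_comb_le c u v : H1 Om u -> H1 Om v ->
  H1sq (fun p => c * u p + v p) <= 2 * c ^+ 2 * H1sq u + 2 * H1sq v.
Proof.
move=> Hu Hv; have Hw := H1_comb c Hu Hv.
rewrite (H1sqE Hw _ (fun i => wderiv_comb i c Hu Hv)); last first.
  by move=> i; apply: L2D => //; [apply: L2Z => //|]; exact: wderiv_L2.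
rewrite /H1sq !mulrDr addrACA lerD//.
  by apply: sqr_Rintegral_comb_le; exact: H1_L2.
rewrite !mulr_sumr -big_split ler_sum// => i _.
by apply: sqr_Rintegral_comb_le; exact: wderiv_L2.
Qed.

Lemma H1sqB_le u v : H1 Om u -> H1 Om v ->
  H1sq (fun p => u p - v p) <= 2 * H1sq u + 2 * H1sq v.
Proof.
move=> Hu Hv; rewrite -oppr_comb addrC.
have := H1sq_comb_le (- 1) Hv Hu.
by rewrite (sqrrN 1) expr1n mulr1.
Qed.

Lemma wderivB i u v : H1 Om u -> H1 Om v ->
  ae_eq (area R) Om (wderiv Om i (fun p => u p - v p))
    (fun p => wderiv Om i u p - wderiv Om i v p).
Proof.
by move=> Hu Hv; rewrite -!oppr_comb; exact: wderiv_comb.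
Qed.

Lemma H1sqBE u v : H1 Om u -> H1 Om v ->
  H1sq (fun p => u p - v p) = \int[area R]_(p in Om) ((u p - v p) ^+ 2) +
    \sum_(i < 2) \int[area R]_(p in Om) ((wderiv Om i u p - wderiv Om i v p) ^+ 2).
Proof.
move=> Hu Hv; apply: (H1sqE (H1B Hu Hv)) => i.
  by apply: L2B => //; exact: wderiv_L2.
exact: wderivB.
Qed.

Lemma H1sq0 : H1sq (fun=> 0) = 0.
Proof.
have E : \int[area R]_(p in Om) ((0 : R) ^+ 2) = 0.
  by rewrite expr0n Rintegral_cst// mul0r.
rewrite (H1sqE (g := fun=> fun=> 0) H10).
- by rewrite E add0r big1.
- by move=> i; exact: L20.
- by move=> i; apply: wderiv_ae_eq; [exact: L20|exact: weak_partial0].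
Qed.

Lemma H1sq_eq0 u : H1 Om u -> H1sq u = 0 ->
  ae_eq (area R) Om u (fun=> 0) /\
  forall i, ae_eq (area R) Om (wderiv Om i u) (fun=> 0).
Proof.
move=> Hu /eqP; rewrite paddr_eq0 ?sqr_Rintegral_ge0//; last first.
  by apply: sumr_ge0 => i _; exact: sqr_Rintegral_ge0.
rewrite psumr_eq0; last by move=> i _; exact: sqr_Rintegral_ge0.
move=> /andP[/eqP u0 /allP du0]; split.
  by apply: (sqr_Rintegral_eq0 mO) => //; exact: H1_L2.
move=> i; apply: (sqr_Rintegral_eq0 mO); first exact: wderiv_L2.
by apply/eqP; apply: du0; rewrite mem_index_enum.
Qed.

(** The functions and their two weak derivatives converge separately in L^2, whence the factor 3;
    Cauchy-Schwarz against a test function shows that the limits of the derivatives are the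
    derivatives of the limit. *)
Lemma H1_complete (u : (R * R -> R)^nat) (K : R) : (forall n, H1 Om (u n)) ->
    (forall n m, (n <= m)%N -> H1sq (fun p => u m p - u n p) <= K * 4 ^- n) ->
  exists2 w, H1 Om w &
    forall n, H1sq (fun p => w p - u n p) <= (K *+ 3) * 4 ^- n.
Proof.
move=> Hu Ku; have fO : (area R Om < +oo)%E by exact: bounded_plane_area.
have [w Lw wu] : exists2 w, L2 (area R) Om w & forall n,
    \int[area R]_(p in Om) ((w p - u n p) ^+ 2) <= K * 4 ^- n.
  apply: L2_complete => // [n|n m nm]; first exact: H1_L2.
  apply: le_trans (Ku _ _ nm); rewrite H1sqBE// lerDl sumr_ge0// => i _.
  exact: sqr_Rintegral_ge0.
have /choice[g Hg] i : exists g, L2 (area R) Om g /\ forall n,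
    \int[area R]_(p in Om) ((g p - wderiv Om i (u n) p) ^+ 2) <= K * 4 ^- n.
  suff [g] : exists2 g, L2 (area R) Om g & forall n,
    \int[area R]_(p in Om) ((g p - wderiv Om i (u n) p) ^+ 2) <= K * 4 ^- n.
    by exists g.
  apply: L2_complete => // [n|n m nm]; first exact: wderiv_L2.
  apply: le_trans (Ku _ _ nm); rewrite H1sqBE// (bigD1 i)//= addrCA lerDl.
  rewrite addr_ge0 ?sqr_Rintegral_ge0// sumr_ge0// => j _.
  exact: sqr_Rintegral_ge0.
have Lg i : L2 (area R) Om (g i) by case: (Hg i).
have wg i : weak_partial Om i w (g i).
  move=> phi tphi.
  have Lphi := test_function_L2 tphi; have Ldphi := partial_test_function_L2 i tphi.
  apply/eqP; rewrite -addr_eq0 -sqrf_eq0 eq_le sqr_ge0 andbT.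
  pose a := \int[area R]_(p in Om) (phi p ^+ 2).
  pose b := \int[area R]_(p in Om) (partial i phi p ^+ 2).
  (* Subtracting the weak derivative identity of [u n] leaves two error terms, whose squares are at
     most [K * b * 4^-n] and [K * a * 4^-n] by Cauchy-Schwarz. *)
  apply: (@le0_of_le_exp4 _ _ (2 * K * (a + b))) => n.
  have [Ldu wdu] := wderivP i (Hu n); have Lu := H1_L2 (Hu n).
  have -> : \int[area R]_(p in Om) (w p * partial i phi p) +
      \int[area R]_(p in Om) (g i p * phi p) =
      \int[area R]_(p in Om) ((w p - u n p) * partial i phi p) +
      \int[area R]_(p in Om) ((g i p - wderiv Om i (u n) p) * phi p).
    under [in RHS]eq_Rintegral do rewrite mulrBl.
    rewrite RintegralB//; try exact: (L2M_integrable mO).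
    under [X in _ = _ + X]eq_Rintegral do rewrite mulrBl.
    rewrite RintegralB//; try exact: (L2M_integrable mO).
    by rewrite (wdu _ tphi); ring.
  have := Rintegral_cauchy_schwarz mO (L2B mO Lw Lu) Ldphi.
  have := Rintegral_cauchy_schwarz mO (L2B mO (Lg i) Ldu) Lphi.
  have := ler_wpM2r (sqr_Rintegral_ge0 phi) ((Hg i).2 n).
  have := ler_wpM2r (sqr_Rintegral_ge0 (partial i phi)) (wu n).
  rewrite -/a -/b.
  set x := \int[_]_(_ in _) _; set y := \int[_]_(_ in _) _.
  set z := \int[_]_(_ in _) _; set t := \int[_]_(_ in _) _.
  by move: (4 ^- n : R) => e h1 h2 h3 h4; have := sqr_ge0 (z - t); nra.
have Hw : H1 Om w by split=> // i; exists (g i).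
exists w => // n; rewrite (@H1sqE _ (fun i p => g i p - wderiv Om i (u n) p)).
- rewrite mulrnAl mulrS lerD//.
  by rewrite (le_trans (ler_sum _ (fun i _ => (Hg i).2 n)))// sumr_const card_ord.
- exact: H1B.
- by move=> i; apply: L2B => //; exact: wderiv_L2.
- move=> i; apply: ae_eq_trans (wderivB i Hw (Hu n)) _.
  have := wderiv_ae_eq (Lg i) (wg i).
  by apply: filterS => p H Op; rewrite H.
Qed.

End sobolev.

(** * Vanishing traces on a part of the boundary *)

Section trace.
Context {R : realType}.
Variables (Om : set (R * R)) (oO : open Om) (bO : bounded_set Om).
Variables (es : seq ((R * R) * (R * R))) (Ga : set (R * R)).
Hypothesis mGa : measurable Ga.
Implicit Types (u v phi psi : R * R -> R) (e : (R * R) * (R * R)) (c : R).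

Lemma edge_path_continuous e : continuous (edge_path e).
Proof.
have aff (a b : R) : continuous (fun s : R => a + s * b).
  by move=> s; apply: cvgD; [exact: cvg_cst|apply: cvgMl; exact: cvg_id].
by move=> s; exact: cvg_pair (aff _ _ s) (aff _ _ s).
Qed.

Lemma edge_part_measurable e :
  measurable (edge_part e Ga : set (measurableTypeR R)).
Proof.
apply: measurableI; first exact: measurable_itv.
have aff (a b : R) : measurable_fun (setT : set R) (fun s : R => a + s * b).
  by apply: measurable_funD => //; exact: measurable_funM.
have m : measurable_fun (setT : set R) (edge_path e : R -> R * R).
  by apply: measurable_fun_pair; exact: aff.
by have := m measurableT _ mGa; rewrite setTI.
Qed.

Lemma edge_part_L2 e phi : continuous phi ->
  L2 (leb R) (edge_part e Ga) (phi \o edge_path e).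
Proof.
move=> cphi; have cpe : continuous (phi \o edge_path e).
  by move=> s; apply: continuous_comp; [exact: edge_path_continuous|exact: cphi].
have : compact ((phi \o edge_path e) @` `[0, 1]).
  apply: continuous_compact; last exact: segment_compact.
  exact: continuous_subspaceT.
move=> /compact_bounded[N [_ HN]].
apply: (bounded_L2 (edge_part_measurable e) (M := N + 1)).
- apply: (@le_lt_trans _ _ (leb R `[0, 1]%classic)).
    apply: le_measure; rewrite ?inE//; first exact: edge_part_measurable.
    exact: subIsetl.
  by rewrite lebesgue_measure_itv/=; case: ifPn => // _; rewrite -EFinB ltry.
- apply: measurable_funTS; exact: continuous_measurable_fun.
- by move=> s [s01 _]; apply: HN; [rewrite ltrDl|exists s].
Qed.

Lemma edge_length_ge0 e : 0 <= edge_length e.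
Proof. exact: sqrtr_ge0. Qed.

Definition bsq phi : R := bint es Ga (fun p => phi p ^+ 2).

Lemma bsq_subr0 phi : bint es Ga (fun p => (phi p - 0) ^+ 2) = bsq phi.
Proof. by rewrite /bsq; congr bint; apply/funext => p; rewrite subr0. Qed.

Lemma bsq_ge0 phi : 0 <= bsq phi.
Proof.
apply: sumr_ge0 => e _; rewrite mulr_ge0 ?edge_length_ge0//.
by apply: Rintegral_ge0 => s _; exact: sqr_ge0.
Qed.

Lemma bsq_comb_le c phi psi : continuous phi -> continuous psi ->
  bsq (c *: phi + psi) <= 2 * c ^+ 2 * bsq phi + 2 * bsq psi.
Proof.
move=> cphi cpsi; rewrite /bsq /bint !mulr_sumr -big_split /=.
apply: ler_sum => e _; have mE := edge_part_measurable e.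
have Lphi := edge_part_L2 e cphi; have Lpsi := edge_part_L2 e cpsi.
rewrite mulrCA [2 * (_ * _)]mulrCA -mulrDr ler_wpM2l ?edge_length_ge0//.
have := L2_sqr_add_le mE (L2Z mE c Lphi) Lpsi.
under [X in _ <= 2 * X + _]eq_Rintegral do rewrite exprMn.
by rewrite RintegralZl ?mulrA//; case: Lphi.
Qed.

Lemma bsq0 : bsq 0 = 0.
Proof.
rewrite /bsq /bint big1// => e _.
under eq_Rintegral do rewrite expr0n.
by rewrite Rintegral_cst ?mul0r ?mulr0//; exact: edge_part_measurable.
Qed.

(** Replacing the approximating sequence by one approximant per tolerance makes linear combinations
    and limits a matter of choosing the tolerance. *)
Lemma is_trace0P u : is_trace Om es Ga u (fun=> 0) <->
  forall eps : R, 0 < eps -> exists phi, [/\ smooth phi, H1 Om phi,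
    H1sq Om (fun p => phi p - u p) < eps & bsq phi < eps].
Proof.
(* The tolerance [d] below is capped at 1 because a norm at most 1 dominates its own square. *)
split=> [[_ [phi [sphi uphi bphi]]] eps eps0|H].
  pose d := Num.min 1 eps.
  have d0 : 0 < d by rewrite lt_min ltr01 eps0.
  have [N _ HN] := (cvgr0Pnorm_lt _).1 uphi _ d0.
  have [N' _ HN'] := (cvgr0Pnorm_lt _).1 bphi _ eps0.
  exists (phi (maxn N N')); have [s1 s2] := sphi (maxn N N'); split=> //.
    have := HN (maxn N N') (leq_maxl _ _); rewrite /= -H1norm_sqr.
    set x := H1norm _ _ => xd; apply: (@le_lt_trans _ _ `|x|); last first.
      by apply: lt_le_trans xd _; rewrite ge_min lexx orbT.
    have x1 : `|x| <= 1.
      by apply: le_trans (ltW xd) _; rewrite ge_min lexx.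
    by rewrite -(real_normK (num_real x)) expr2 ler_piMl.
  have := HN' (maxn N N') (leq_maxr _ _); rewrite /=.
  by rewrite bsq_subr0 ger0_norm// bsq_ge0.
split.
  move=> e _; apply: (@L20 _ _ _ (leb R) (edge_part e Ga)).
  exact: edge_part_measurable.
have /choice[phi Hphi] n : exists phi, [/\ smooth phi, H1 Om phi,
    H1sq Om (fun p => phi p - u p) < n.+1%:R^-1 ^+ 2 & bsq phi < n.+1%:R^-1].
  (* The tolerance is squared because it bounds the squared H^1 norm; on the boundary [n.+1%:R^-1]
     is enough. *)
  have [] := H (n.+1%:R^-1 ^+ 2); first by rewrite exprn_gt0.
  move=> phi [? ? ? bphi]; exists phi; split=> //; apply: lt_le_trans bphi _.
  by rewrite expr2 ler_piMl// invf_le1 ?ler1n.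
exists phi; split.
- by move=> n; case: (Hphi n).
- apply: (@squeeze_cvgr _ _ _ _ (fun=> 0) (fun n => n.+1%:R^-1)).
  + apply: nearW => n; rewrite sqrtr_ge0/=; case: (Hphi n) => _ _ + _.
    by rewrite -H1norm_sqr ltr_sqr ?nnegrE ?sqrtr_ge0 ?invr_ge0// => /ltW.
  + exact: cvg_cst.
  + exact: cvg_harmonic.
- apply: (@squeeze_cvgr _ _ _ _ (fun=> 0) (fun n => n.+1%:R^-1)).
  + apply: nearW => n; case: (Hphi n) => _ _ _ h.
    by rewrite bsq_subr0 bsq_ge0 ltW.
  + exact: cvg_cst.
  + exact: cvg_harmonic.
Qed.

End trace.

(** * Linearity and completeness of V *)

Section trial_space.
Context {R : realType}.
Variables (Om : set (R * R)) (oO : open Om) (bO : bounded_set Om).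
Variables (es : seq ((R * R) * (R * R))) (Ga : set (R * R)).
Hypothesis mGa : measurable Ga.

Lemma is_trace0_comb (c : R) (u v : R * R -> R) : H1 Om u -> H1 Om v ->
  is_trace Om es Ga u (fun=> 0) -> is_trace Om es Ga v (fun=> 0) ->
  is_trace Om es Ga (fun p => c * u p + v p) (fun=> 0).
Proof.
move=> Hu Hv /(is_trace0P Om es mGa) tu /(is_trace0P Om es mGa) tv.
apply/(is_trace0P Om es mGa) => eps eps0.
have k0 : 0 < 2 * c ^+ 2 + 3 by rewrite ltr_wpDl// mulr_ge0// sqr_ge0.
(* Both squared norms of the combination are bounded by [2 * c ^+ 2 * x + 2 * y] with [x, y < d],
   which is below [2 * c ^+ 2 * d + 3 * d = eps]. *)
pose d := eps / (2 * c ^+ 2 + 3); have d0 : 0 < d by rewrite divr_gt0.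
have lt_eps x y : x < d -> y < d -> 2 * c ^+ 2 * x + 2 * y < eps.
  move=> xd yd; rewrite (_ : eps = 2 * c ^+ 2 * d + 3 * d).
    apply: ler_ltD; first by apply: ler_wpM2l (ltW xd); rewrite mulr_ge0// sqr_ge0.
    by rewrite (@lt_trans _ _ (2 * d)) ?ltr_pM2l// ltr_pM2r// ltr_nat.
  by rewrite -mulrDl mulrC /d divfK ?gt_eqF.
have [phi [sphi Hphi phiu bphi]] := tu _ d0.
have [psi [spsi Hpsi psiv bpsi]] := tv _ d0.
exists (c *: phi + psi); split.
- exact: smooth_comb.
- exact: (H1_comb oO bO c Hphi Hpsi).
- rewrite (_ : (fun p => _) =
    (fun p => c * (phi p - u p) + (psi p - v p))); last first.
    by apply/funext => p; rewrite !fctE /GRing.scale /=; ring.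
  have := H1sq_comb_le oO bO c (H1B oO bO Hphi Hu) (H1B oO bO Hpsi Hv).
  move/le_lt_trans; apply.
  exact: lt_eps.
- have := bsq_comb_le es mGa c (smooth_continuous sphi) (smooth_continuous spsi).
  by move/le_lt_trans; apply; exact: lt_eps.
Qed.

Lemma is_trace00 : is_trace Om es Ga (fun=> 0) (fun=> 0).
Proof.
apply/(is_trace0P Om es mGa) => eps eps0; exists 0; split.
- exact: smooth0.
- exact: H10.
- rewrite (_ : (fun p => _) = fun=> 0) ?H1sq0//.
  by apply/funext => p; rewrite subr0.
- by rewrite bsq0.
Qed.

Lemma exp4_lt (K e : R) : 0 < e -> exists n, K * 4 ^- n < e.
Proof.
move=> e0; apply: contrapT => H; have : e <= 0; last by rewrite leNgt e0.
apply: (@le0_of_le_exp4 _ _ K) => n; rewrite leNgt; apply/negP => h.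
by apply: H; exists n.
Qed.

(** A smooth approximant of [u n], with [n] large, also serves for [w]: its boundary term involves
    [phi] alone, so it is inherited unchanged, and only the H^1 distance has to be re-estimated, as
    [2 * (eps / 4) + 2 * (eps / 4)]. *)
Lemma is_trace0_limit (w : R * R -> R) (u : (R * R -> R)^nat) (K : R) :
  H1 Om w -> (forall n, H1 Om (u n)) ->
  (forall n, is_trace Om es Ga (u n) (fun=> 0)) ->
  (forall n, H1sq Om (fun p => w p - u n p) <= K * 4 ^- n) ->
  is_trace Om es Ga w (fun=> 0).
Proof.
move=> Hw Hu tu wu; apply/(is_trace0P Om es mGa) => eps eps0.
have d0 : 0 < eps / 4 by rewrite divr_gt0.
have [n Kn] := exp4_lt K d0.
have /(is_trace0P Om es mGa) /(_ _ d0) [phi [sphi Hphi phiu bphi]] := tu n.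
exists phi; split=> //; last first.
  by apply: lt_le_trans bphi _; rewrite ler_pdivrMr// ler_peMr ?ler1n// ltW.
rewrite (_ : (fun p => _) = (fun p => (phi p - u n p) - (w p - u n p))); last first.
  by apply/funext => p; ring.
apply: le_lt_trans (H1sqB_le oO bO (H1B oO bO Hphi (Hu n)) (H1B oO bO Hw (Hu n))) _.
move: (wu n) phiu Kn; move: (H1sq _ _) (H1sq _ _) (4 ^- n : R) => y x e; lra.
Qed.

Implicit Types (u v w : R * R -> 'cV[R]_2) (c : R).

Lemma component_comb c u v k : component (c *: u + v) k =
  fun p => c * component u k p + component v k p.
Proof. by apply/funext => p; rewrite /component !fctE !mxE. Qed.

Lemma componentB u v k : component (u - v) k =
  fun p => component u k p - component v k p.
Proof. by apply/funext => p; rewrite /component !fctE !mxE. Qed.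

Lemma component0 k : component (0 : R * R -> 'cV[R]_2) k = fun=> 0.
Proof. by apply/funext => p; rewrite /component (_ : 0 p = 0)// mxE. Qed.

Lemma V_H1 u k : V Om es Ga u -> H1 Om (component u k).
Proof. by move=> /(_ k)[]. Qed.

Lemma V_comb c u v : V Om es Ga u -> V Om es Ga v -> V Om es Ga (c *: u + v).
Proof.
move=> Vu Vv k; have [Hu tu] := Vu k; have [Hv tv] := Vv k.
by rewrite component_comb; split; [exact: H1_comb|exact: is_trace0_comb].
Qed.

Lemma V0 : V Om es Ga 0.
Proof. by move=> k; rewrite component0; split; [exact: H10|exact: is_trace00]. Qed.

Lemma VB u v : V Om es Ga u -> V Om es Ga v -> V Om es Ga (u - v).
Proof. by move=> Vu Vv; rewrite addrC -scaleN1r; exact: V_comb. Qed.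

Definition Vsq u : R := \sum_(k < 2) H1sq Om (component u k).

Lemma Vsq_ge0 u : 0 <= Vsq u.
Proof. by apply: sumr_ge0 => k _; exact: H1sq_ge0. Qed.

Lemma Vnorm_sqr u : Vnorm Om u ^+ 2 = Vsq u.
Proof.
rewrite sqr_sqrtr; last by apply: sumr_ge0 => k _; exact: sqr_ge0.
by apply: eq_bigr => k _; exact: H1norm_sqr.
Qed.

(** The limit is assembled componentwise; 6 is the factor 3 of [H1_complete] for each of two
    components. *)
Lemma V_complete (u : (R * R -> 'cV[R]_2)^nat) (K : R) :
    (forall n, V Om es Ga (u n)) ->
    (forall n m, (n <= m)%N -> Vsq (u m - u n) <= K * 4 ^- n) ->
  exists2 w, V Om es Ga w &
    forall n, Vsq (w - u n) <= (K *+ 6) * 4 ^- n.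
Proof.
move=> Vu Ku.
have /choice[g Hg] (k : 'I_2) : exists g, H1 Om g /\ forall n,
    H1sq Om (fun p => g p - component (u n) k p) <= (K *+ 3) * 4 ^- n.
  have [||g Hg gu] := H1_complete oO bO (u := fun n => component (u n) k) (K := K).
  - by move=> n; exact: V_H1.
  - move=> n m nm; apply: le_trans (Ku _ _ nm).
    rewrite -componentB /Vsq (bigD1 k)//= lerDl sumr_ge0// => j _.
    exact: H1sq_ge0.
  by exists g.
pose w : R * R -> 'cV[R]_2 := fun p => \col_k g k p.
have wE k : component w k = g k.
  by apply/funext => p; rewrite /component /w mxE.
exists w.
  move=> k; rewrite wE; have [Hgk gu] := Hg k; split=> //.
  apply: (is_trace0_limit Hgk _ _ gu) => n; first exact: V_H1.
  by have [_] := Vu n k.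
move=> n; have H k : H1sq Om (component (w - u n) k) <= (K *+ 3) * 4 ^- n.
  by rewrite componentB wE; exact: (Hg k).2.
rewrite /Vsq (le_trans (ler_sum _ (fun k _ => H k)))// sumr_const card_ord.
by rewrite -mulrnAl -mulrnA.
Qed.

End trial_space.

(** * The displacement and mixed problems *)

Section strain_fields.
Context {R : realType}.
Variables (Om : set (R * R)) (oO : open Om) (bO : bounded_set Om).
Implicit Types (e f g : R * R -> 'cV[R]_3) (c : R) (D : 'M[R]_3).

Let mO := open_plane_measurable oO.

Lemma dotvE n (x y : 'cV[R]_n) : dotv x y = \sum_k x k 0 * y k 0.
Proof. by rewrite /dotv mxE; apply: eq_bigr => k _; rewrite mxE. Qed.

Lemma dotvDl n c (x y z : 'cV[R]_n) :
  dotv (c *: x + y) z = c * dotv x z + dotv y z.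
Proof. by rewrite /dotv linearP mulmxDl -scalemxAl !mxE. Qed.

Lemma dotvC n (x y : 'cV[R]_n) : dotv x y = dotv y x.
Proof. by rewrite !dotvE; apply: eq_bigr => k _; rewrite mulrC. Qed.

Lemma dotv0l n (x : 'cV[R]_n) : dotv 0 x = 0.
Proof. by rewrite dotvE big1// => k _; rewrite mxE mul0r. Qed.

Lemma dotvv_eq0 n (x : 'cV[R]_n) : dotv x x = 0 -> x = 0.
Proof.
rewrite dotvE => /eqP; rewrite psumr_eq0; last first.
  by move=> k _; rewrite -expr2 sqr_ge0.
move=> /allP H; apply/matrixP => i j; rewrite ord1 mxE; apply/eqP.
by rewrite -sqrf_eq0 expr2; apply: H; rewrite mem_index_enum.
Qed.

Lemma W_comb c e f : W Om e -> W Om f -> W Om (fun p => c *: e p + f p).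
Proof.
move=> We Wf k; rewrite (_ : component _ k =
    fun p => c * component e k p + component f k p).
  by apply: L2D => //; apply: L2Z.
by apply/funext => p; rewrite /component !mxE.
Qed.

Lemma W0 : W Om (fun=> 0).
Proof.
move=> k; rewrite (_ : component _ k = fun=> 0); first exact: L20.
by apply/funext => p; rewrite /component mxE.
Qed.

Lemma WB e f : W Om e -> W Om f -> W Om (fun p => e p - f p).
Proof.
move=> We Wf; have := W_comb (- 1) Wf We.
by under eq_fun do rewrite scaleN1r addrC.
Qed.

Lemma L2_sum (I : Type) (r : seq I) (F : I -> R * R -> R) :
  (forall i, L2 (area R) Om (F i)) ->
  L2 (area R) Om (fun p => \sum_(i <- r) F i p).
Proof.
move=> LF; elim: r => [|i r IH].
  by under eq_fun do rewrite big_nil; exact: L20.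
by under eq_fun do rewrite big_cons; exact: L2D.
Qed.

Lemma W_mulmx D e : W Om e -> W Om (fun p => D *m e p).
Proof.
move=> We k; rewrite (_ : component _ k =
    fun p => \sum_j D k j * component e j p).
  by apply: L2_sum => j; exact: L2Z.
by apply/funext => p; rewrite /component mxE.
Qed.

Lemma dotv_integrable e f : W Om e -> W Om f ->
  (area R).-integrable Om (EFin \o (fun p => dotv (e p) (f p))).
Proof.
move=> We Wf.
have : (area R).-integrable Om
    (fun p => \sum_k (component e k p * component f k p)%:E)%E.
  by apply: integrable_sum => // k _; exact: (L2M_integrable mO).
by apply: eq_integrable => // p _; rewrite sumEFin /= dotvE.
Qed.

Lemma inner_comb c e f g : W Om e -> W Om f -> W Om g ->
  \int[area R]_(p in Om) dotv (c *: e p + f p) (g p) =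
  c * \int[area R]_(p in Om) dotv (e p) (g p) +
  \int[area R]_(p in Om) dotv (f p) (g p).
Proof.
move=> We Wf Wg; under eq_Rintegral do rewrite dotvDl.
by rewrite (Rintegral_comb mO) //; exact: dotv_integrable.
Qed.

Lemma innerC e f : \int[area R]_(p in Om) dotv (e p) (f p) =
  \int[area R]_(p in Om) dotv (f p) (e p).
Proof. by apply: eq_Rintegral => p _; rewrite dotvC. Qed.

Lemma inner_ae_eq e f g : W Om e -> W Om f -> W Om g ->
  ae_eq (area R) Om e f ->
  \int[area R]_(p in Om) dotv (e p) (g p) =
  \int[area R]_(p in Om) dotv (f p) (g p).
Proof.
move=> We Wf Wg ef; apply: Rintegral_ae_eq => //.
- by apply/measurable_EFinP; exact: measurable_int (dotv_integrable We Wg).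
- by apply/measurable_EFinP; exact: measurable_int (dotv_integrable Wf Wg).
- by apply: filterS ef => p H Op; rewrite H.
Qed.

Lemma inner0l f : \int[area R]_(p in Om) dotv 0 (f p) = 0.
Proof.
under eq_Rintegral do rewrite dotv0l.
by rewrite Rintegral_cst// mul0r.
Qed.

Lemma inner0r f : \int[area R]_(p in Om) dotv (f p) 0 = 0.
Proof. by rewrite innerC inner0l. Qed.

Lemma inner_eq0 e : W Om e -> \int[area R]_(p in Om) dotv (e p) (e p) = 0 ->
  ae_eq (area R) Om e (fun=> 0).
Proof.
move=> We e0.
have Ie := dotv_integrable We We.
have E : (\int[area R]_(p in Om) `|(dotv (e p) (e p))%:E| = 0)%E.
  rewrite -[RHS](congr1 EFin e0) (fineK (integrable_fin_num mO Ie)).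
  apply: eq_integral => p _; rewrite gee0_abs// lee_fin dotvE.
  by apply: sumr_ge0 => k _; rewrite -expr2 sqr_ge0.
have /(ae_eq_integral_abs _ mO (measurable_int _ Ie)) := E.
by apply: filterS => p H Op; apply: dotvv_eq0; have [] := H Op.
Qed.

Lemma ae_eq_subr0 e f : ae_eq (area R) Om (fun p => e p - f p) (fun=> 0) ->
  ae_eq (area R) Om e f.
Proof.
by apply: filterS => p H Op; apply/eqP; rewrite -subr_eq0 H.
Qed.

(** The difference [e - f] is itself an admissible test field. *)
Lemma inner_test_ae_eq e f : W Om e -> W Om f ->
  (forall g, W Om g -> \int[area R]_(p in Om) dotv (e p - f p) (g p) = 0) ->
  ae_eq (area R) Om e f.
Proof.
move=> We Wf H; apply: ae_eq_subr0; apply: inner_eq0; first exact: WB.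
by apply: H; exact: WB.
Qed.

Variables (es : seq ((R * R) * (R * R))) (Ga : set (R * R)).
Implicit Types (u v w : R * R -> 'cV[R]_2).

Lemma B_W u : V Om es Ga u -> W Om (B Om u).
Proof.
move=> Vu k; have L i j := wderiv_L2 i (V_H1 j Vu).
have E : component (B Om u) k = fun p => [:: wderiv Om 0 (component u 0) p;
    wderiv Om 1 (component u 1) p;
    wderiv Om 1 (component u 0) p + wderiv Om 0 (component u 1) p]`_k.
  by apply/funext => p; rewrite /component mxE.
rewrite E; case: k {E} => -[|[|[|k]]] // lt_k /=; try exact: L.
by apply: L2D => //; exact: L.
Qed.

Lemma B_comb c u v : V Om es Ga u -> V Om es Ga v ->
  ae_eq (area R) Om (B Om (c *: u + v)) (fun p => c *: B Om u p + B Om v p).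
Proof.
move=> Vu Vv; have H i j := wderiv_comb oO bO i c (V_H1 j Vu) (V_H1 j Vv).
have H00 := H 0 0; have H01 := H 0 1; have H10 := H 1 0; have H11 := H 1 1.
apply: filterS2 (filterI H00 H01) (filterI H10 H11).
move=> p [h00 h01] [h10 h11] Op; apply/matrixP => k j; rewrite ord1 !mxE.
rewrite (component_comb c u v 0) (component_comb c u v 1).
rewrite (h00 Op) (h01 Op) (h10 Op) (h11 Op).
move: (wderiv _ _ _ p) (wderiv _ _ _ p) (wderiv _ _ _ p) (wderiv _ _ _ p).
move: (wderiv _ _ _ p) (wderiv _ _ _ p) (wderiv _ _ _ p) (wderiv _ _ _ p).
move=> x1 x2 x3 x4 x5 x6 x7 x8.
case: k => -[|[|[|k]]] // lt_k /=.
by rewrite mulrDr addrACA.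
Qed.

End strain_fields.

(** * The bilinear form, and fields of zero norm *)

Section energy.
Context {R : realType}.
Variables (Om : set (R * R)) (oO : open Om) (bO : bounded_set Om).
Variables (es : seq ((R * R) * (R * R))) (Ga : set (R * R)) (D : 'M[R]_3).
Implicit Types (u v w : R * R -> 'cV[R]_2) (c : R).

Let mO := open_plane_measurable oO.

Lemma stress_W u : V Om es Ga u -> W Om (fun p => D *m B Om u p).
Proof. by move=> Vu; apply: (W_mulmx oO); exact: B_W. Qed.

Lemma aform_comb c u v w : measurable Ga ->
  V Om es Ga u -> V Om es Ga v -> V Om es Ga w ->
  aform Om D (c *: u + v) w = c * aform Om D u w + aform Om D v w.
Proof.
move=> mGa Vu Vv Vw; have Vuv := V_comb oO bO mGa c Vu Vv.
rewrite /aform -(inner_comb oO);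
  [|exact: stress_W|exact: stress_W|exact: (B_W oO Vw)].
apply: (inner_ae_eq oO).
- exact: stress_W.
- by apply: (W_comb oO); exact: stress_W.
- exact: (B_W oO Vw).
- apply: filterS (B_comb oO bO c Vu Vv) => p H Op.
  by rewrite (H Op) mulmxDr scalemxAr.
Qed.

Lemma Vsq_eq0 u : V Om es Ga u -> Vsq Om u = 0 ->
  ae_eq (area R) Om u (fun=> 0).
Proof.
move=> Vu /eqP; rewrite psumr_eq0; last by move=> k _; exact: H1sq_ge0.
move=> /allP H.
have Z k : ae_eq (area R) Om (component u k) (fun=> 0).
  have /eqP u0 : H1sq Om (component u k) == 0 by apply: H; rewrite mem_index_enum.
  by have [] := H1sq_eq0 oO (V_H1 k Vu) u0.
apply: filterS2 (Z 0) (Z 1) => p h0 h1 Op.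
apply/matrixP => k j; rewrite ord1 mxE.
have [->|->] : k = 0 \/ k = 1.
- by case: k => -[|[|k]] // lt_k; [left|right]; exact: val_inj.
- exact: h0.
- exact: h1.
Qed.

(** The H^1 norm contains the derivatives that make up the strain. This carries uniqueness from
    displacements to strains and stresses. *)
Lemma Vsq_eq0_B u : V Om es Ga u -> Vsq Om u = 0 ->
  ae_eq (area R) Om (B Om u) (fun=> 0).
Proof.
move=> Vu /eqP; rewrite psumr_eq0; last by move=> k _; exact: H1sq_ge0.
move=> /allP H.
have Z i k : ae_eq (area R) Om (wderiv Om i (component u k)) (fun=> 0).
  have /eqP u0 : H1sq Om (component u k) == 0 by apply: H; rewrite mem_index_enum.
  by have [_] := H1sq_eq0 oO (V_H1 k Vu) u0; apply.
have H00 := Z 0 0; have H01 := Z 0 1; have H10 := Z 1 0; have H11 := Z 1 1.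
apply: filterS2 (filterI H00 H01) (filterI H10 H11).
move=> p [h00 h01] [h10 h11] Op; apply/matrixP => k j; rewrite ord1 !mxE.
rewrite (h00 Op) (h01 Op) (h10 Op) (h11 Op).
by case: k => -[|[|[|k]]] // lt_k /=; rewrite addr0.
Qed.

End energy.

Theorem proposition4p1 (R : realType)
    (Om : set (R * R)) (es : seq ((R * R) * (R * R)))
    (GaD GaN : set (R * R)) (D : 'M[R]_3) (b t : R * R -> 'cV[R]_2)
    (hOm : polygonal_domain Om es)
    (hGaD : GaD `<=` boundary Om) (mGaD : measurable GaD)
    (hGaD0 : GaD !=set0) (hGaN : GaN = boundary Om `\` GaD)
    (hD : sym_posdef D)
    (ha_sym : symmetric_on (V Om es GaD) (aform Om D))
    (ha_cont : bounded_form_on (V Om es GaD) (Vnorm Om) (aform Om D))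
    (ha_coer : coercive_on (V Om es GaD) (Vnorm Om) (aform Om D))
    (hf_def : load_defined Om es GaD GaN b t)
    (hf : bounded_linear_on (V Om es GaD) (Vnorm Om) (load Om es GaN b t)) :
  exists (u : R * R -> 'cV[R]_2) (e1 e2 s1 s2 : R * R -> 'cV[R]_3),
    [/\ mixed_solution Om es GaD GaN D b t u e1 e2 s1 s2,
        forall u' e1' e2' s1' s2',
          mixed_solution Om es GaD GaN D b t u' e1' e2' s1' s2' ->
          [/\ ae_eq (area R) Om u' u,
              ae_eq (area R) Om e1' e1, ae_eq (area R) Om e2' e2,
              ae_eq (area R) Om s1' s1 & ae_eq (area R) Om s2' s2],
        forall v, V Om es GaD v -> aform Om D u v = load Om es GaN b t v,
        ae_eq (area R) Om e1 (B Om u) /\ ae_eq (area R) Om e2 (B Om u) &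
        ae_eq (area R) Om s1 (fun p => D *m B Om u p) /\
        ae_eq (area R) Om s2 (fun p => D *m B Om u p)].
Proof.
have oO := poly_open hOm; have bO := poly_bounded hOm.
have mO := open_plane_measurable oO.
have [alpha alpha0 acoer] := ha_coer.
have [C0 abnd] := ha_cont.
have [flin [C1 fbnd]] := hf.
have acoer' v : V Om es GaD v -> Vsq Om v <= alpha^-1 * aform Om D v v.
  by move=> Vv; rewrite ler_pdivlMl// -Vnorm_sqr; exact: acoer.
have V0' := V0 oO bO es mGaD.
(* Continuity of the load and coercivity give [(f v)^2 <= C1^2 * Vsq v <= C1^2 / alpha * a v v],
   hence the constant. *)
have [||||u Vu au] := @riesz_representation R _ (V Om es GaD) (aform Om D)
  (load Om es GaN b t) (C1 ^+ 2 * alpha^-1) V0' (V_comb oO bO mGaD) ha_sym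
  (fun c u v w => @aform_comb _ _ oO bO es GaD D c u v w mGaD) _ flin.
- by move=> v Vv; apply: le_trans (acoer _ Vv); rewrite mulr_ge0 ?sqr_ge0 ?ltW.
- by rewrite mulr_ge0 ?sqr_ge0 ?invr_ge0 ?ltW.
- move=> v Vv; rewrite -mulrA; apply: le_trans (ler_wpM2l (sqr_ge0 _) (acoer' _ Vv)).
  rewrite -Vnorm_sqr -exprMn -[leLHS]real_normK ?num_real//.
  by rewrite ler_sqr ?nnegrE ?normr_ge0// (le_trans _ (fbnd _ Vv)).
- move=> u K Vu Ku.
  have [||l Vl lu] := @V_complete _ _ oO bO es _ mGaD u (alpha^-1 * K).
  + by [].
  + move=> n m nm; apply: le_trans (acoer' _ (VB oO bO mGaD (Vu m) (Vu n))) _.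
    by rewrite -mulrA; apply: ler_wpM2l (Ku _ _ nm); rewrite invr_ge0 ltW.
  (* Continuity of the form converts the rate in H^1 back to a rate in energy. The absolute value is
     there because the sign of [C0] is not given. *)
  exists l => //; exists (`|C0| * ((alpha^-1 * K) *+ 6)) => n.
  have Vd := VB oO bO mGaD Vl (Vu n).
  apply: le_trans (ler_norm _) _; apply: le_trans (abnd _ _ Vd Vd) _.
  rewrite -mulrA -expr2 Vnorm_sqr -[leRHS]mulrA.
  apply: le_trans (ler_wpM2l (normr_ge0 C0) (lu n)).
  by rewrite ler_wpM2r ?Vsq_ge0// ler_norm.
have WBu := B_W oO Vu; have WDBu := stress_W oO D Vu.
exists u, (B Om u), (B Om u), (fun p => D *m B Om u p), (fun p => D *m B Om u p).
(* The load at 0 contains a trace picked by choice and does not simply compute to 0; additivity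
   gives [f 0 = f 0 + f 0]. *)
have f0 : load Om es GaN b t 0 = 0.
  have := flin 1 0 0 V0' V0'; rewrite scale1r addr0 mul1r.
  by move=> /(congr1 (fun x => x - load Om es GaN b t 0)); rewrite subrr addrK.
split; [| |exact: au|by split; exact: ae_eq_refl|by split; exact: ae_eq_refl].
- apply: MixedSolution; [exact: Vu|exact: WBu|exact: WBu|exact: WDBu|exact: WDBu| |].
  + move=> v d1 d2 Vv Wd1 Wd2; under [X in _ + X + _]eq_Rintegral do rewrite addNr.
    under [X in _ + X]eq_Rintegral do rewrite subrr.
    by rewrite !(inner0l oO) !addr0; exact: au.
  + move=> t1 t2 Wt1 Wt2; under [X in X + _]eq_Rintegral do rewrite subrr.
    under [X in _ + X]eq_Rintegral do rewrite subrr.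
    by rewrite !(inner0r oO) addr0.
move=> u' e1' e2' s1' s2' [Vu' We1 We2 Ws1 Ws2 eq1 eq2].
have W0' : W Om (fun=> 0) := W0 oO.
have WBu' := B_W oO Vu'; have WDBu' := stress_W oO D Vu'.
have e1E : ae_eq (area R) Om (B Om u') e1'.
  apply: (inner_test_ae_eq oO) => // g Wg.
  have := eq2 g (fun=> 0) Wg W0'.
  by rewrite (inner0l oO) addr0 innerC.
have e2E : ae_eq (area R) Om e1' e2'.
  apply: (inner_test_ae_eq oO) => // g Wg.
  have := eq2 (fun=> 0) g W0' Wg.
  by rewrite (inner0l oO) add0r innerC.
(* [B Om 0] is built from chosen weak derivatives and is not literally 0. The first equation with
   all test fields 0 makes this integral equal to the load at 0. *)
have s1B0 : \int[area R]_(p in Om) dotv (s1' p) (B Om 0 p) = 0.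
  by have := eq1 0 (fun=> 0) (fun=> 0) V0' W0' W0'; rewrite !(inner0r oO) !addr0 f0.
have s12E : ae_eq (area R) Om s2' s1'.
  apply: (inner_test_ae_eq oO) => // g Wg.
  have := eq1 0 g (fun=> 0) V0' Wg W0'.
  rewrite s1B0 (inner0r oO) add0r addr0 f0.
  by under eq_Rintegral do rewrite addrC.
have s2E : ae_eq (area R) Om (fun p => D *m e2' p) s2'.
  apply: (inner_test_ae_eq oO) => //; first exact: (W_mulmx oO).
  move=> g Wg; have := eq1 0 (fun=> 0) g V0' W0' Wg.
  by rewrite s1B0 (inner0r oO) !add0r f0.
have s1E : ae_eq (area R) Om s1' (fun p => D *m B Om u' p).
  apply: filterS2 (filterI e1E e2E) (filterI s12E s2E).
  by move=> p [h1 h2] [h3 h4] Op; rewrite -(h3 Op) -(h4 Op) -(h2 Op) -(h1 Op).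
have au' v : V Om es GaD v -> aform Om D u' v = load Om es GaN b t v.
  move=> Vv; have := eq1 v (fun=> 0) (fun=> 0) Vv W0' W0'.
  rewrite !(inner0r oO) !addr0 => <-; apply/esym.
  exact: (inner_ae_eq oO Ws1 WDBu' (B_W oO Vv) s1E).
have Vd := VB oO bO mGaD Vu' Vu.
have dE : u' - u = - 1 *: u + u' by rewrite scaleN1r addrC.
(* Only the first argument of the form is expanded: both displacements give the same load on the
   test field [u' - u], so its energy is 0 and coercivity concludes. *)
have d0 : Vsq Om (u' - u) = 0.
  apply/eqP; rewrite eq_le Vsq_ge0 andbT; apply: le_trans (acoer' _ Vd) _.
  rewrite {1}dE (aform_comb oO bO D _ mGaD Vu Vu' Vd) au// au'//.
  by rewrite mulN1r addNr mulr0.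
have uE : ae_eq (area R) Om u' u.
  apply: filterS (Vsq_eq0 oO Vd d0) => p H Op.
  by apply/eqP; rewrite -subr_eq0; apply/eqP; exact: H.
have BE : ae_eq (area R) Om (B Om u') (B Om u).
  have H := Vsq_eq0_B oO Vd d0; rewrite dE in H.
  apply: filterS2 H (B_comb oO bO (- 1) Vu Vu') => p h1 h2 Op.
  have := h2 Op; rewrite (h1 Op) scaleN1r addrC => /esym/eqP.
  by rewrite subr_eq0 => /eqP.
split; first exact: uE.
- by apply: filterS2 e1E BE => p h1 h2 Op; rewrite -(h1 Op) (h2 Op).
- apply: filterS2 (filterI e1E e2E) BE => p [h1 h2] h3 Op.
  by rewrite -(h2 Op) -(h1 Op) (h3 Op).
- by apply: filterS2 s1E BE => p h1 h2 Op; rewrite (h1 Op) (h2 Op).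
- apply: filterS2 (filterI s1E s12E) BE => p [h1 h2] h3 Op.
  by rewrite (h2 Op) (h1 Op) (h3 Op).
Qed.
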